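(* Let $K,M\in\mathbb N$, $P>0$. Let $\mathcal X=\mathcal X_1\times\dots\times\mathcal X_K$ be a feature alphabet, $\mathcal Y\subseteq\mathbb R$ a label alphabet, and let $f:\mathcal X\to\mathbb R$ be an estimator of additive form $f(x_1,\dots,x_K)=\sum_{k=1}^Kf_k(x_k)$ with measurable $f_k:\mathcal X_k\to\mathbb R$ of bounded range. Let $\mathcal L:\mathcal X\times\mathcal Y\times\mathbb R\to[0,\infty)$ be a $\Lambda$-Lipschitz-continuous loss. Consider the $M$-use channel with fading and noise correlated as determined by matrices $A,B$, and let $A_i$ generate user-uncorrelated fading with $\|(A+A_i)(A-A_i)^T\|\le\eta$. Let $\varepsilon>0$, $\delta\in(0,1)$, and suppose $$M\ge\frac{\log4-\log\delta}{\varepsilon^2}\max\big(16F+D+4\varepsilon L,\ 256F+32\varepsilon L\big),$$ where $L=\big(\sqrt{\bar\Delta(f)}\|A\|+\sqrt{\Delta(f)/P}\,\|B\|\big)^2$, $F=L\big(\sqrt{\bar\Delta(f)/M}\,\|A\|_F+\sqrt{\Delta(f)/(PM)}\,\|B\|_F\big)^2$, $D=\big(4\sqrt{2M}\,\bar\Delta(f)\eta+4\frac{\Delta(f)}{\sqrt{PM}}\|AB^T\|_F\big)^2$. Then, given $x^K=(x_1,\dots,x_K)\in\mathcal X$ drawn from an arbitrary distribution (in particular with arbitrarily correlated components), with $x_k$ available at transmitter $k$, and any $y\in\mathcal Y$, through $M$ uses of the channel the receiver can obtain (by an admissible DFA scheme) an estimate $\bar f$ of $f(x^K)$ satisfying $$\mathbb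 P\big(|\mathcal L(x^K,y,\bar f)-\mathcal L(x^K,y,f(x^K))|\ge\Lambda\varepsilon\big)\le\delta .$$
   Context: $\|\cdot\|$ and $\|\cdot\|_F$ are the operator and Frobenius norms of matrices; $\log$ is the natural logarithm. The loss $\mathcal L$ is $\Lambda$-Lipschitz-continuous if for all $x\in\mathcal X$, $y\in\mathcal Y$ the map $\mathcal L(x,y,\cdot)$ is Lipschitz with constant at most $\Lambda$. Spreads: $\bar\Delta(f):=\sum_{k=1}^K(\sup f_k-\inf f_k)$, $\Delta(f):=\max_k(\sup f_k-\inf f_k)$ (sup and inf over $\mathcal X_k$). Sub-Gaussian norm: for a real random variable $X$, $\tau(X):=\inf\{t>0:\forall\lambda\in\mathbb R,\ \mathbb E\exp(\lambda(X-\mathbb EX))\le\exp(\lambda^2t^2/2)\}$; $X$ is sub-Gaussian if $\tau(X)<\infty$. Channel: for $m=1,\dots,M$ the output is $Y(m)=\sum_{k=1}^KH_k(m)z_k(m)+N(m)$, with inputs $z_k(m)\in\mathbb C$, $|z_k(m)|^2\le P$. The complex random variables $H_k(m)=H_k^r(m)+iH_k^i(m)$ have sub-Gaussian real and imaginary parts with mean $0$ and variance $1$; $N(m)=N^r(m)+iN^i(m)$ has sub-Gaussian real and imaginary parts with mean $0$. Put $H:=(H(1),\dots,H(2M))^T\in\mathbb R^{2KM}$ with blocks $H(2m-1):=(H_1^r(m),\dots,H_K^r(m))$, $H(2m):=(H_1^i(m),\dots,H_K^i(m))$, and $N:=(N^r(1),N^i(1),\dots,N^r(M),N^i(M))^T\in\mathbb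 R^{2M}$. Fading and noise are ''correlated as determined by $A\in\mathbb R^{2KM\times(2KM+2M)}$ and $B\in\mathbb R^{2M\times(2KM+2M)}$'' if there is a random vector $R$ with $2KM+2M$ independent real entries, each of sub-Gaussian norm at most $1$, such that $H=AR$ and $N=BR$. User-uncorrelated: a matrix $A_i\in\mathbb R^{2KM\times(2KM+2M)}$, split vertically into $2M$ consecutive blocks $A_i^{(1)},\dots,A_i^{(2M)}\in\mathbb R^{K\times(2KM+2M)}$, generates user-uncorrelated fading if each block has at most one nonzero entry per column. Admissible DFA scheme with $M$ channel uses: encoders $E_k^M(x_k)=(E_k(m,x_k,U_k(m)))_{m=1}^M\in\mathbb C^M$, $k=1,\dots,K$, where the $U_k(m)$ are random variables, jointly independent of $(H,N)$ and of the data, the map $(x_k,t_1,\dots,t_M)\mapsto(E_k(m,x_k,t_m))_{m=1}^M$ is measurable, and $|E_k(m,x_k,U_k(m))|^2\le P$; together with a measurable decoder $D^M:\mathbb C^M\to\mathbb R$. The resulting estimate is $D^M(Y(1),\dots,Y(M))$ when $z_k(m)=E_k(m,x_k,U_k(m))$. The data $x^K$ is independent of $(H,N)$.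
   Formalization: The Lipschitz constant Λ is assumed to be positive: for Λ = 0 the loss difference is always 0 = Λε, so the event has probability 1 > δ and the claim as printed fails. *)

(* Defs.v *)
From HB Require Import structures.
From mathcomp Require Import all_boot all_order all_algebra.
From mathcomp Require Import complex.
From mathcomp Require Import all_classical all_reals all_analysis.

Set Implicit Arguments.
Unset Strict Implicit.
Unset Printing Implicit Defensive.

Import Order.TTheory GRing.Theory Num.Def Num.Theory.
Import numFieldNormedType.Exports.

Local Open Scope classical_set_scope.
Local Open Scope ring_scope.
Local Open Scope complex_scope.

(* The Borel sigma-algebra of the complex plane, pulled back from [R * R]. *)
Section complex_measurable.
Context (R : realType).

Definition complex_pair (z : R[i]) : R * R := (complex.Re z, complex.Im z).

Definition complex_measurable : set (set R[i]) :=
  preimage_set_system [set: R[i]] complex_pair measurable.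

Let complex_measurable_sigma : sigma_algebra [set: R[i]] complex_measurable.
Proof. by apply: sigma_algebra_preimage; exact: sigma_algebra_measurable. Qed.

Let complex_measurable0 : complex_measurable set0.
Proof. by have [] := complex_measurable_sigma. Qed.

Let complex_measurableC (A : set R[i]) :
  complex_measurable A -> complex_measurable (~` A).
Proof.
by move=> mA; rewrite -setTD; have [_ h _] := complex_measurable_sigma; exact: h.
Qed.

Let complex_measurable_bigcup (F : (set R[i])^nat) :
  (forall n, complex_measurable (F n)) -> complex_measurable (\bigcup_n F n).
Proof. by have [_ _ h] := complex_measurable_sigma; exact: h. Qed.

HB.instance Definition _ := isPointed.Build R[i] 0.
HB.instance Definition _ := @isMeasurable.Build default_measure_display R[i]
  complex_measurable complex_measurable0 complex_measurableC
  complex_measurable_bigcup.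

End complex_measurable.

Section matrix_norms.
Context (R : realType).

Definition frobenius_norm m n (A : 'M[R]_(m, n)) : R :=
  Num.sqrt (\sum_(i < m) \sum_(j < n) A i j ^+ 2).

(* On a column vector the Frobenius norm is the Euclidean norm. *)
Definition operator_norm m n (A : 'M[R]_(m, n)) : R :=
  sup [set frobenius_norm (A *m v) | v in [set v : 'cV[R]_n | frobenius_norm v <= 1]].

End matrix_norms.

Section random_variables.
Context d (Omega : measurableType d) (R : realType) (P : probability Omega R).

(* For a non-integrable [X] the set below is empty whatever the junk value of
   ['E_P[X]] is, so that [tau = +oo]. *)
Definition subgaussian_norm (X : Omega -> R) : \bar R :=
  ereal_inf [set t%:E | t in [set t : R | 0 < t /\
    forall l : R, ('E_P[fun w => expR (l * (X w - fine 'E_P[X]))] <=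
                   (expR (l ^+ 2 * t ^+ 2 / 2))%:E)%E]].

Definition subgaussian (X : Omega -> R) := (subgaussian_norm X < +oo)%E.

Definition mutually_independent (I : finType) (X : I -> Omega -> R) :=
  forall (J : {set I}) (E : I -> set R),
    (forall i, i \in J -> measurable (E i)) ->
    (P (\bigcap_(i in [set` J]) (X i @^-1` E i)) =
     \prod_(i in J) P (X i @^-1` E i))%E.

End random_variables.

(* Everything is numbered from 0: channel use [m] owns the blocks [2 * m] (real
   parts) and [2 * m + 1] (imaginary parts), and the entry of user [k] in block
   [b] has index [b * K + k] in the stacked fading vector. *)
Section real_coordinates.
Context {K M : nat}.

Fact re_block_subproof (m : 'I_M) : (2 * m < 2 * M)%N.
Proof. by rewrite ltn_pmul2l. Qed.

Fact im_block_subproof (m : 'I_M) : (2 * m + 1 < 2 * M)%N.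
Proof. by rewrite addn1 !mul2n ltn_Sdouble. Qed.

Fact fading_row_subproof (b : 'I_(2 * M)) (k : 'I_K) : (b * K + k < 2 * K * M)%N.
Proof.
have bK : (b * K + k < b.+1 * K)%N by rewrite [ltnRHS]mulSn [ltnRHS]addnC ltn_add2l.
by rewrite (leq_trans bK)// -mulnA [(K * M)%N]mulnC mulnA leq_mul2r ltn_ord orbT.
Qed.

Definition re_block (m : 'I_M) : 'I_(2 * M) := Ordinal (re_block_subproof m).
Definition im_block (m : 'I_M) : 'I_(2 * M) := Ordinal (im_block_subproof m).
Definition fading_row (b : 'I_(2 * M)) (k : 'I_K) : 'I_(2 * K * M) :=
  Ordinal (fading_row_subproof b k).

End real_coordinates.

Definition user_uncorrelated (R : realType) (K M : nat)
    (Ai : 'M[R]_(2 * K * M, 2 * K * M + 2 * M)) :=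
  forall (b : 'I_(2 * M)) (j : 'I_(2 * K * M + 2 * M)) (k k' : 'I_K),
    Ai (fading_row b k) j != 0 -> Ai (fading_row b k') j != 0 -> k = k'.

Section channel.
Context d (Omega : measurableType d) (R : realType) (P : probability Omega R).
Context (K M : nat).

(* [H = A R] and [N = B R], read row by row. *)
Definition correlated_as_determined_by
    (H : 'I_K -> 'I_M -> {RV P >-> R[i]}) (N : 'I_M -> {RV P >-> R[i]})
    (A : 'M[R]_(2 * K * M, 2 * K * M + 2 * M))
    (B : 'M[R]_(2 * M, 2 * K * M + 2 * M)) :=
  exists X : 'I_(2 * K * M + 2 * M) -> {RV P >-> R},
    [/\ mutually_independent P (fun j => X j : Omega -> R),
        forall j, (subgaussian_norm P (X j) <= 1)%E,
        forall w k m,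
          let AX := A *m \col_j X j w in
          complex.Re (H k m w) = AX (fading_row (re_block m) k) 0 /\
          complex.Im (H k m w) = AX (fading_row (im_block m) k) 0
      & forall w m,
          let BX := B *m \col_j X j w in
          complex.Re (N m w) = BX (re_block m) 0 /\
          complex.Im (N m w) = BX (im_block m) 0].

Definition standardized_subgaussian (X : Omega -> R) :=
  [/\ subgaussian P X, 'E_P[X]%E = 0%E & 'V_P[X]%E = 1%E].

Definition centered_subgaussian (X : Omega -> R) :=
  subgaussian P X /\ 'E_P[X]%E = 0%E.

End channel.

(* The transmitters' randomness lives on a probability space of its own; it is
   combined with the spaces of the channel and of the data by taking product
   measures, which is how independence of the three is expressed. *)
Record dfa_scheme (R : realType) (K M : nat) (power : R)
    (dX : 'I_K -> measure_display) (X : forall k, measurableType (dX k)) :=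
  DfaScheme {
    dfa_display : measure_display;
    dfa_space : measurableType dfa_display;
    dfa_prob : probability dfa_space R;
    dfa_rand : 'I_K -> 'I_M -> {RV dfa_prob >-> R};
    dfa_enc : forall k, 'I_M -> X k -> R -> R[i];
    dfa_dec : M.-tuple R[i] -> R;
    dfa_enc_measurable : forall k,
      measurable_fun [set: X k * M.-tuple R]
        (fun p => [tuple dfa_enc m p.1 (tnth p.2 m) | m < M]);
    dfa_enc_power : forall k m (x : X k) u,
      `|dfa_enc m x (dfa_rand k m u)| ^+ 2 <= power%:C;
    dfa_dec_measurable : measurable_fun [set: M.-tuple R[i]] dfa_dec }.

Definition dfa_estimate (R : realType) (K M : nat) (power : R)
    (dX : 'I_K -> measure_display) (X : forall k, measurableType (dX k))
    (S : dfa_scheme M power X) (h : 'I_K -> 'I_M -> R[i]) (n : 'I_M -> R[i])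
    (x : forall k, X k) (u : dfa_space S) : R :=
  dfa_dec S [tuple
    \sum_(k < K) h k m * dfa_enc S m (x k) (dfa_rand S k m u) + n m | m < M].

Arguments dfa_estimate {R K M power dX X} S h n x u.

Section spreads.
Context (R : realType) (K : nat) (X : 'I_K -> Type) (f : forall k, X k -> R).

Definition spread (k : 'I_K) : R := sup (range (@f k)) - inf (range (@f k)).
Definition total_spread : R := \sum_(k < K) spread k.

(* Spreads are nonnegative, hence the default value 0 is harmless. *)
Definition max_spread : R := \big[Num.max/0]_(k < K) spread k.

End spreads.

(* Main.v *)
(* Transmitter k sends, in every channel use, a real symbol whose energy is
   proportional to f_k(x_k) - inf f_k and whose sign is an independent fair coin
   flip.  As the fading has unit variance, the suitably scaled received energy
   estimates f(x) up to a known constant, without bias.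

   With H = A R and N = B R the scaled received energy is |G(u) R|^2, where u is
   the vector of signs.  The matrix G(u) is bounded, uniformly in u, in operator
   norm by sqrt W and in Frobenius norm by sqrt (V / W), where L = 2 M W and
   F = 4 M V.  The deviation of |G(u) R|^2 from its conditional mean given u is
   split into its off-diagonal part, a sub-Gaussian chaos, and its diagonal part,
   a sum of independent terms; the conditional mean itself is a chaos of the same
   kind plus a linear form in the signs u.  The exponential moment of a chaos is
   bounded by integrating the coordinates out one at a time: by Gaussian mixing
   every integration replaces the form by a Schur complement, and the sum of its
   trace and three times its squared Frobenius norm pays for the factor that is
   lost.  The theorem follows by Markov's inequality for the exponential. *)

Require Import Defs.
From HB Require Import structures.
From mathcomp Require Import all_boot all_order all_algebra.
From mathcomp Require Import complex ring lra.
From mathcomp Require Import all_classical all_reals all_analysis measurable_realfun.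

Set Implicit Arguments.
Unset Strict Implicit.
Unset Printing Implicit Defensive.

Import Order.TTheory GRing.Theory Num.Def Num.Theory.
Import numFieldNormedType.Exports.

Local Open Scope classical_set_scope.
Local Open Scope ring_scope.
Local Open Scope complex_scope.

(** * Sub-Gaussian exponential moments *)

(** The fading of different users may be arbitrarily correlated, so for fixed symbols the mean
    received energy contains cross terms between users. The signs give these mean zero, while
    squared signs are 1 and leave the wanted terms untouched. The full quadratic form cannot be used
    directly: its trace enters the exponent linearly, whereas the second moments of the entries of R
    are only known to be at most 1. Without its diagonal the form has trace zero, so its bound is
    purely quadratic in the exponential parameter t and serves both tails; the diagonal is compared
    with the exact second moments. The two parts are dependent and are joined by Cauchy-Schwarz,
    which doubles t. This explains the condition |t| W <= 1/32: the diagonal part asks for 2 |t| W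
    <= 1/16, and the chaos in the signs for 2 |t| (2 W) <= 1/8, as the real and imaginary parts of
    one channel use carry the same signs. *)

Section gaussian_mixing.
Context (R : realType).

(** Completing the square; positivity of [1 - 2 * a] keeps the tilted function a multiple of a
    normal density. *)
Lemma normal_pdf_tilt (a t g : R) : a < 1 / 2 ->
  expR (a * g ^+ 2 + t * g) * normal_pdf 0 1 g =
  (Num.sqrt (1 - 2 * a))^-1 * expR (t ^+ 2 / (2 * (1 - 2 * a))) *
  normal_pdf (t / (1 - 2 * a)) (Num.sqrt (1 - 2 * a))^-1 g.
Proof.
move=> a12; set c := 1 - 2 * a.
have c0 : 0 < c by rewrite /c; lra.
have sc0 : 0 < Num.sqrt c by rewrite sqrtr_gt0.
have cE : Num.sqrt c ^+ 2 = c by rewrite sqr_sqrtr// ltW.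
rewrite !normal_pdfE ?oner_neq0 ?invr_neq0 ?gt_eqF//.
have -> : normal_peak (Num.sqrt c)^-1 = Num.sqrt c * normal_peak 1.
  rewrite /normal_peak exprVn cE -!mulrnAr expr1n mul1r sqrtrM ?invr_ge0 ?ltW//.
  by rewrite invfM sqrtrV ?ltW// invrK.
rewrite mulrCA (_ : expR _ * _ =
    expR (t ^+ 2 / (2 * c)) * normal_fun (t / c) (Num.sqrt c)^-1 g).
  by field; rewrite gt_eqF.
rewrite /normal_fun -!expRD; congr expR.
rewrite exprVn cE subr0 expr1n !mulr2n.
have -> : a = (1 - c) / 2 by rewrite /c; field.
by field; rewrite gt_eqF.
Qed.

Lemma measurable_gaussian_tilt (a t : R) : measurable_fun [set: R]
  (fun g : R => (expR (a * g ^+ 2 + t * g) * normal_pdf 0 1 g)%:E).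
Proof.
apply/measurable_EFinP; apply: measurable_funM; last exact: measurable_normal_pdf.
apply: measurableT_comp => //; apply: measurable_funD; last exact: measurable_funM.
by apply: measurable_funM => //; exact: measurable_funX.
Qed.

Lemma gaussian_tilt_ge0 (a t g : R) :
  0 <= expR (a * g ^+ 2 + t * g) * normal_pdf 0 1 g.
Proof. by rewrite mulr_ge0 ?expR_ge0 ?normal_pdf_ge0. Qed.

Lemma gaussian_tilt_integral (a t : R) : a < 1 / 2 ->
  (\int[lebesgue_measure]_g (expR (a * g ^+ 2 + t * g) * normal_pdf 0 1 g)%:E =
   ((Num.sqrt (1 - 2 * a))^-1 * expR (t ^+ 2 / (2 * (1 - 2 * a))))%:E)%E.
Proof.
move=> a12; under eq_integral do rewrite normal_pdf_tilt// EFinM.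
rewrite ge0_integralZl//.
- by rewrite integral_normal_pdf mule1.
- by apply/measurable_EFinP; exact: measurable_normal_pdf.
- by move=> x _; rewrite lee_fin normal_pdf_ge0.
Qed.

End gaussian_mixing.

Section subgaussian_mgf.
Context d (Omega : measurableType d) (R : realType) (P : probability Omega R).

Definition mgf_le_gaussian (X : Omega -> R) :=
  forall l : R, (\int[P]_w (expR (l * X w))%:E <= (expR (l ^+ 2 / 2))%:E)%E.

(* If [g] is standard normal then [expR (a * x ^+ 2)] is the expectation of
   [expR (s * x * g)], where [s ^+ 2 = 2 * a]; exchange the two integrations. *)
Lemma quadratic_mgf_le (X : Omega -> R) (a b : R) :
  measurable_fun setT X -> mgf_le_gaussian X -> 0 <= a < 1 / 2 ->
  (\int[P]_w (expR (a * X w ^+ 2 + b * X w))%:E <=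
   ((Num.sqrt (1 - 2 * a))^-1 * expR (b ^+ 2 / (2 * (1 - 2 * a))))%:E)%E.
Proof.
move=> mX X_sub /andP[a0 a12].
pose mu := @lebesgue_measure R.
set s := Num.sqrt (2 * a).
have sE : s ^+ 2 = 2 * a by rewrite sqr_sqrtr// mulr_ge0.
pose phi (z : Omega * R) : R :=
  expR (b * X z.1 + s * X z.1 * z.2) * normal_pdf 0 1 z.2.
have phi0 z : 0 <= phi z by rewrite mulr_ge0 ?expR_ge0 ?normal_pdf_ge0.
have mphi : measurable_fun setT (fun z => (phi z)%:E).
  apply/measurable_EFinP; apply: measurable_funM; last first.
    by apply: measurableT_comp; [exact: measurable_normal_pdf|exact: measurable_snd].
  apply: measurableT_comp => //; apply: measurable_funD.
    by apply: measurable_funM => //; apply: measurableT_comp.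
  apply: measurable_funM => //; apply: measurable_funM => //.
  exact: measurableT_comp.
have phi_snd w : (\int[mu]_g (phi (w, g))%:E =
    (expR (a * X w ^+ 2 + b * X w))%:E)%E.
  transitivity (\int[mu]_g ((expR (b * X w))%:E *
      (expR (0 * g ^+ 2 + s * X w * g) * normal_pdf 0 1 g)%:E))%E.
    apply: eq_integral => g _; rewrite -EFinM /phi/= mul0r add0r expRD.
    by rewrite !mulrA.
  rewrite ge0_integralZl//; last 2 first.
  - exact: measurable_gaussian_tilt.
  - by move=> g _; rewrite lee_fin gaussian_tilt_ge0.
  rewrite gaussian_tilt_integral ?mulr0 ?subr0 ?sqrtr1 ?invr1 ?mul1r; last by lra.
  rewrite -EFinM -expRD; congr (expR _)%:E.
  by rewrite exprMn sE; field.
(* Sub-Gaussianity at [s * g + b] yields a quadratic in [g] with leading coefficient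
   [s^2 / 2 = a < 1 / 2], still integrable against the Gaussian. *)
have phi_fst g : (\int[P]_w (phi (w, g))%:E <=
    (expR ((s * g + b) ^+ 2 / 2) * normal_pdf 0 1 g)%:E)%E.
  rewrite (_ : \int[P]_w _ = (normal_pdf 0 1 g)%:E *
      \int[P]_w (expR ((s * g + b) * X w))%:E)%E; last first.
    rewrite -ge0_integralZl//.
    - apply: eq_integral => w _; rewrite -EFinM mulrC /phi/=; congr (expR _ * _)%:E.
      by ring.
    - by apply/measurable_EFinP; apply: measurableT_comp => //; exact: measurable_funM.
    - by rewrite lee_fin normal_pdf_ge0.
  by rewrite [in leRHS]mulrC EFinM lee_wpmul2l// lee_fin normal_pdf_ge0.
rewrite (eq_integral (fun w => \int[mu]_g (phi (w, g))%:E)%E); last first.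
  by move=> w _; rewrite phi_snd.
have phi0E z : (0 <= (phi z)%:E)%E by rewrite lee_fin.
have -> : (\int[P]_w \int[mu]_g (phi (w, g))%:E =
    \int[mu]_g \int[P]_w (phi (w, g))%:E)%E.
  exact: (@fubini_tonelli _ _ _ _ _ P mu _ mphi phi0E).
apply: (@le_trans _ _ (\int[mu]_g ((expR (b ^+ 2 / 2))%:E *
    (expR (a * g ^+ 2 + s * b * g) * normal_pdf 0 1 g)%:E)))%E.
  apply: ge0_le_integral => //.
  - by move=> g _; apply: integral_ge0 => w _; rewrite lee_fin.
  - exact: (@measurable_fun_fubini_tonelli_G _ _ _ _ _ P (fun z => (phi z)%:E) mphi phi0E).
  - by apply: emeasurable_funM => //; exact: measurable_gaussian_tilt.
  - move=> g _; apply: (le_trans (phi_fst g)); rewrite -EFinM lee_fin mulrA -expRD.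
    suff -> : (s * g + b) ^+ 2 / 2 = b ^+ 2 / 2 + (a * g ^+ 2 + s * b * g) by [].
    have -> : (s * g + b) ^+ 2 = s ^+ 2 * g ^+ 2 + 2 * (s * b * g) + b ^+ 2 by ring.
    by rewrite sE; field.
rewrite ge0_integralZl//; last 2 first.
- exact: measurable_gaussian_tilt.
- by move=> g _; rewrite lee_fin gaussian_tilt_ge0.
rewrite gaussian_tilt_integral// -EFinM lee_fin mulrCA -expRD.
suff -> : b ^+ 2 / 2 + (s * b) ^+ 2 / (2 * (1 - 2 * a)) =
  b ^+ 2 / (2 * (1 - 2 * a)) by [].
by rewrite exprMn sE; field; lra.
Qed.

End subgaussian_mgf.

(** * Independence *)

Section independence.
Context d (Omega : measurableType d) (R : realType) (P : probability Omega R).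
Context (I : finType) (X : I -> Omega -> R).
Hypothesis mX : forall i, measurable_fun setT (X i).
Hypothesis indepX : mutually_independent P X.
Variable j : I.

(** Boxes in the coordinates other than [j]. They are closed under intersection, as uniqueness of
    measures requires, and [setT] leaves a coordinate free. *)
Definition other_events : set (set Omega) :=
  [set A | exists2 E : I -> set R, (forall i, measurable (E i)) &
    A = \bigcap_(i in [set` [set~ j]%SET]) (X i @^-1` E i)].

(* The sample space with the sigma-algebra generated by the [X i], [i != j]. *)
Definition others := g_sigma_algebraType other_events.

Lemma other_events_measurable A : other_events A -> measurable A.
Proof.
move=> [E mE ->]; apply: fin_bigcap_measurable; first exact: finite_finset.
by move=> i _; rewrite -[_ @^-1` _]setTI; exact: mX.
Qed.

Lemma others_measurable A : measurable (A : set others) -> d.-measurable A.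
Proof.
apply: smallest_sub; first exact: sigma_algebra_measurable.
exact: other_events_measurable.
Qed.

Lemma measurable_id_others : measurable_fun setT (id : Omega -> others).
Proof. by move=> _ A mA; rewrite setTI; exact: others_measurable. Qed.

Lemma measurable_others i : i != j -> measurable_fun setT (X i : others -> R).
Proof.
move=> ij _ E mE; rewrite setTI; apply: sub_sigma_algebra.
exists (fun k => if k == i then E else setT) => [k|]; first by case: ifP.
rewrite eqEsubset; split=> [w Ew k _|w Xw].
  by rewrite /preimage/=; have [->|//] := eqVneq k i.
by have := Xw i; rewrite /preimage/= eqxx; apply; rewrite in_setC1.
Qed.

(** As functions of [A] both sides are finite measures, a restriction and a multiple of [P]; they
    agree on the boxes that generate [others]. *)
Lemma others_independent A E : measurable (A : set others) -> measurable E ->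
  (P (A `&` X j @^-1` E) = P A * P (X j @^-1` E))%E.
Proof.
move=> mA mE.
have mXE : measurable (X j @^-1` E) by rewrite -[_ @^-1` _]setTI; exact: mX.
have XE_fin : (P (X j @^-1` E) \is a fin_num) by exact: fin_num_measure.
have XE_ge0 : 0 <= fine (P (X j @^-1` E)) by exact: fine_ge0.
rewrite -[X in (_ * X)%E]fineK// muleC.
apply: (@g_sigma_algebra_measure_unique _ _ _ other_events
  other_events_measurable (fun=> setT) _ _
  (mrestr P mXE) (mscale (NngNum XE_ge0) P)) => //.
- by move=> _; exists (fun=> setT) => //; rewrite eqEsubset; split.
- by rewrite bigcup_const.
- move=> _ _ [E1 mE1 ->] [E2 mE2 ->]; exists (fun i => E1 i `&` E2 i).
    by move=> i; exact: measurableI.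
  by rewrite eqEsubset; split=> [w [h1 h2] i ij|w h]; [split; [exact: h1|exact: h2]|
    split=> i ij; have [] := h _ ij].
- move=> _ [F mF ->] /=; rewrite /mrestr /mscale/= fineK//.
  pose G i := if i == j then E else F i.
  have G_other : \bigcap_(i in [set` [set~ j]%SET]) (X i @^-1` G i) =
      \bigcap_(i in [set` [set~ j]%SET]) (X i @^-1` F i).
    by apply: eq_bigcapr => i; rewrite /= in_setC1 /G => /negbTE ->.
  have mG i : measurable (G i) by rewrite /G; case: ifP.
  have := @indepX [set: I]%SET G (fun i _ => mG i).
  have := @indepX [set~ j]%SET G (fun i _ => mG i).
  rewrite G_other => ->.
  rewrite (_ : \bigcap_(i in _) _ =
      \bigcap_(i in [set` [set~ j]%SET]) (X i @^-1` F i) `&` X j @^-1` E); last first.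
    rewrite -G_other eqEsubset; split=> [w h|w [h hj] i _].
      have {}h i : (X i @^-1` G i) w by apply: h; rewrite /= finset.in_setT.
      by split=> [i _|]; [exact: h|have := h j; rewrite /G /preimage/= eqxx].
    by have [->|ij] := eqVneq i j; [rewrite /G /= eqxx|apply: h; rewrite /= in_setC1].
  move=> ->; rewrite (bigD1 j)//= {1}/G eqxx; congr (_ * _)%E.
  by apply: eq_big => [i|i ij]; rewrite ?in_setC1 ?finset.in_setT// /G (negbTE ij).
- by move=> _; change (P (setT `&` X j @^-1` E) < +oo)%E; rewrite setTI ltey_eq XE_fin.
Qed.

(** Conditioning without conditional expectations: measurability over [others] means that the first
    argument of [phi] acts only through the other coordinates, and the joint law of the identity
    into [others] and of [X j] is a product, so Tonelli applies. *)
Lemma integral_others (phi : others * R -> R) :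
  measurable_fun setT phi -> (forall z, 0 <= phi z) ->
  (\int[P]_w (phi (w, X j w))%:E =
   \int[P]_w \int[P]_v (phi (w, X j v))%:E)%E.
Proof.
move=> mphi phi0.
have mjoint : measurable_fun setT (fun w => (w, X j w) : others * R).
  by apply/measurable_fun_pairP; split; [exact: measurable_id_others|exact: mX].
pose idm : {mfun Omega >-> others} := HB.pack (id : Omega -> others)
  (isMeasurableFun.Build _ _ _ _ _ measurable_id_others).
pose Xj : {mfun Omega >-> R} := HB.pack (X j)
  (isMeasurableFun.Build _ _ _ _ _ (@mX j)).
pose joint : {mfun Omega >-> (others * R)%type} :=
  HB.pack (fun w => (w, X j w) : others * R)
  (isMeasurableFun.Build _ _ _ _ _ mjoint).
have law A : measurable A ->
    ((distribution P idm \x distribution P Xj) A = distribution P joint A)%E.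
  apply: product_measure_unique => B E mB mE.
  by rewrite /distribution /pushforward -others_independent.
have mphiE : measurable_fun setT (EFin \o phi) by exact/measurable_EFinP.
have phi0E z : (0 <= (EFin \o phi) z)%E by rewrite /= lee_fin.
transitivity (\int[distribution P joint]_z (EFin \o phi) z)%E.
  by rewrite ge0_integral_distribution.
transitivity (\int[distribution P idm \x distribution P Xj]_z (EFin \o phi) z)%E.
  by apply: eq_measure_integral => A mA _; apply/esym; exact: law.
rewrite fubini_tonelli1//.
rewrite ge0_integral_distribution//.
- apply: eq_integral => w _; rewrite /fubini_F/= ge0_integral_distribution//.
  - apply: (@measurableT_comp _ _ _ _ _ _ (EFin \o phi) _ (pair w)) => //.
  - by move=> v; rewrite lee_fin.
- exact: measurable_fun_fubini_tonelli_F.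
- by move=> w; apply: integral_ge0 => v _; rewrite /= lee_fin.
Qed.

End independence.

Section independent_families.
Context d (Omega : measurableType d) (R : realType) (P : probability Omega R).
Context (I : finType) (X : I -> Omega -> R).
Hypothesis mX : forall i, measurable_fun setT (X i).
Hypothesis indepX : mutually_independent P X.

Lemma integral_others_le j (phi : others X j * R -> R) (psi : Omega -> R) :
  measurable_fun setT phi -> (forall z, 0 <= phi z) ->
  measurable_fun setT psi ->
  (forall w, \int[P]_v (phi (w, X j v))%:E <= (psi w)%:E)%E ->
  (\int[P]_w (phi (w, X j w))%:E <= \int[P]_w (psi w)%:E)%E.
Proof.
move=> mphi phi0 mpsi phi_psi; rewrite integral_others//.
have phi0E w : (0 <= \int[P]_v (phi (w, X j v))%:E)%E.
  by apply: integral_ge0 => v _; rewrite lee_fin.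
apply: ge0_le_integral => //.
- pose g (z : others X j * Omega) : \bar R := (phi (z.1, X j z.2))%:E.
  have mg : measurable_fun setT g.
    apply/measurable_EFinP/(measurableT_comp mphi).
    apply/measurable_fun_pairP; split; first exact: measurable_fst.
    exact: (measurableT_comp (@mX j) measurable_snd).
  have g0 z : (0 <= g z)%E by rewrite lee_fin.
  have mF := @measurable_fun_fubini_tonelli_F _ _ _ _ _ P _ mg g0.
  move=> _ B mB; have := mF measurableT B mB; rewrite !setTI.
  exact: others_measurable.
- by apply/measurable_EFinP.
Qed.

Lemma measurable_sum_in d' (T : measurableType d') (s : seq I) (g : I -> T -> R) :
  {in s, forall i, measurable_fun setT (g i)} ->
  measurable_fun setT (fun w => \sum_(i <- s) g i w).
Proof.
elim: s => [_|i s IHs mg].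
  by under eq_fun do rewrite big_nil; exact: measurable_cst.
under eq_fun do rewrite big_cons; apply: measurable_funD.
  by apply: mg; rewrite mem_head.
by apply: IHs => k ks; apply: mg; rewrite inE ks orbT.
Qed.

Lemma integral_scale (c : R) (f : Omega -> R) : 0 <= c ->
  measurable_fun setT f -> (forall w, 0 <= f w) ->
  (\int[P]_w (c * f w)%:E = c%:E * \int[P]_w (f w)%:E)%E.
Proof.
move=> c0 mf f0; under eq_integral do rewrite EFinM.
rewrite ge0_integralZl//; first exact/measurable_EFinP.
by move=> w _; rewrite lee_fin.
Qed.

Lemma integral_prod_le (s : seq I) (h : I -> R -> R) (c : I -> R) :
  uniq s -> (forall i, measurable_fun setT (h i)) ->
  (forall i x, 0 <= h i x) ->
  (forall i, \int[P]_w (h i (X i w))%:E <= (c i)%:E)%E ->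
  (\int[P]_w (\prod_(i <- s) h i (X i w))%:E <= (\prod_(i <- s) c i)%:E)%E.
Proof.
move=> us mh h0 hc.
have c0 i : 0 <= c i.
  by rewrite -lee_fin (le_trans _ (hc i))// integral_ge0// => w _; rewrite lee_fin.
elim: s us => [_|j s IHs /= /andP[js us]].
  under eq_integral do rewrite big_nil.
  by rewrite big_nil integral_cst// mul1e [leLHS]probability_setT.
have mprod d' (T : measurableType d') (Y : I -> T -> R) :
    {in s, forall i, measurable_fun setT (Y i)} ->
    measurable_fun setT (fun w => \prod_(i <- s) h i (Y i w)).
  by move=> mY; apply: measurable_prod => i si; apply: measurableT_comp => //; exact: mY.
have prod0 (w : Omega) : 0 <= \prod_(i <- s) h i (X i w) by rewrite prodr_ge0.
have mprodO := mprod _ _ X (fun i _ => @mX i).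
under eq_integral do rewrite big_cons.
have := @integral_others_le j (fun z => h j z.2 * \prod_(i <- s) h i (X i z.1))
  (fun w => c j * \prod_(i <- s) h i (X i w)).
move=> /= le_c; apply: (le_trans (le_c _ _ _ _)).
- apply: measurable_funM; first exact: (measurableT_comp (@mh j) measurable_snd).
  pose Y i (w : others X j * R) := X i w.1.
  apply: (mprod _ _ Y) => i si; apply: measurableT_comp; last exact: measurable_fst.
  by apply: measurable_others; apply: contraNneq js => <-.
- by move=> z; rewrite mulr_ge0.
- exact: measurable_funM.
- move=> w; under eq_integral do rewrite mulrC.
  rewrite integral_scale// ?EFinM 1?[in leRHS]muleC ?lee_wpmul2l ?lee_fin//.
  exact: (measurableT_comp (@mh j)).
- by rewrite big_cons integral_scale// EFinM lee_wpmul2l ?lee_fin// IHs.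
Qed.

End independent_families.

(** * Quadratic chaos *)

Section quadratic_forms.
Context (R : realType) (I : eqType).
Implicit Types (S : I -> I -> R) (s : seq I) (v : I -> R).

Definition qform s S v : R := \sum_(i <- s) \sum_(k <- s) S i k * (v i * v k).

Definition is_symmetric S := forall i k, S i k = S k i.

(** For symmetric [S] and duplicate-free [s], a bound on the operator norm, in a form that is
    exploited by plugging in test vectors. *)
Definition qform_bounded s S (c : R) :=
  forall v, `|qform s S v| <= c * \sum_(i <- s) v i ^+ 2.

Lemma qform_cons j s S v : is_symmetric S ->
  qform (j :: s) S v = S j j * v j ^+ 2 +
    2 * v j * (\sum_(i <- s) S i j * v i) + qform s S v.
Proof.
move=> symS; rewrite /qform big_cons big_cons.
under [X in _ + X = _]eq_bigr do rewrite big_cons.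
rewrite big_split/= !addrA; congr (_ + _).
rewrite -expr2 -!addrA; congr (_ + _).
have -> : \sum_(k <- s) S j k * (v j * v k) = v j * \sum_(i <- s) S i j * v i.
  by rewrite mulr_sumr; apply: eq_bigr => i _; rewrite (symS j) mulrCA.
rewrite (_ : \sum_(i <- s) S i j * (v i * v j) = v j * \sum_(i <- s) S i j * v i).
  by ring.
by rewrite mulr_sumr; apply: eq_bigr => i _; ring.
Qed.

(* Twice this matrix is [1] minus the Schur complement of the [j]-th diagonal
   entry of [1 - 2 S]. *)
Definition schur S j i k : R := S i k + 2 * S i j * S k j / (1 - 2 * S j j).

Lemma schur_sym S j : is_symmetric S -> is_symmetric (schur S j).
Proof. by move=> symS i k; rewrite /schur symS -!mulrA (mulrCA (S i j)). Qed.

Lemma qform_schur s S j v : qform s (schur S j) v =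
  qform s S v + 2 * (\sum_(i <- s) S i j * v i) ^+ 2 / (1 - 2 * S j j).
Proof.
rewrite /qform expr2 mulr_suml !mulr_sumr mulr_suml -big_split/=.
apply: eq_bigr => i _; rewrite !mulr_sumr mulr_suml -big_split/=.
by apply: eq_bigr => k _; rewrite /schur; ring.
Qed.

Lemma qform_update j s S v t : is_symmetric S -> j \notin s ->
  qform (j :: s) S (fun i => if i == j then t else v i) =
    S j j * t ^+ 2 + 2 * t * (\sum_(i <- s) S i j * v i) + qform s S v.
Proof.
move=> symS js.
have vs i : i \in s -> (if i == j then t else v i) = v i.
  by move=> si; case: eqP => // ij; rewrite -ij si in js.
rewrite qform_cons// eqxx; congr (_ + _ * _ + _).
  by apply: eq_big_seq => i si; rewrite vs.
by apply: eq_big_seq => i si; apply: eq_big_seq => k sk; rewrite !vs.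
Qed.

Lemma sum_update j s v t : j \notin s ->
  \sum_(i <- j :: s) (if i == j then t else v i) ^+ 2 =
    t ^+ 2 + \sum_(i <- s) v i ^+ 2.
Proof.
move=> js; rewrite big_cons eqxx; congr (_ + _); apply: eq_big_seq => i si.
by case: eqP => // ij; rewrite -ij si in js.
Qed.

Section elimination.
Variables (j : I) (s : seq I) (S : I -> I -> R) (c : R).
Hypotheses (symS : is_symmetric S) (js : j \notin s).
Hypothesis S_bnd : qform_bounded (j :: s) S c.

Lemma qform_bounded_tail : qform_bounded s S c.
Proof.
move=> v; have := S_bnd (fun i => if i == j then 0 else v i).
by rewrite qform_update// sum_update// expr0n/= !(mulr0, mul0r) !add0r.
Qed.

Lemma qform_bounded_diag : `|S j j| <= c.
Proof.
have := S_bnd (fun i => if i == j then 1 else 0).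
have s0 (F : I -> R) : \sum_(i <- s) F i * 0 = 0 by rewrite big1// => i; rewrite mulr0.
have q0 : qform s S (fun=> 0) = 0.
  by rewrite /qform big1// => i _; rewrite big1// => k _; rewrite !mulr0.
rewrite (@qform_update j s S (fun=> 0) 1)// (@sum_update j s (fun=> 0) 1)// s0 q0.
rewrite big1 => [|i _]; last by rewrite expr0n.
by rewrite expr1n !(mulr1, mulr0, addr0).
Qed.

(** Test vectors: the [j]-th column outside [j], and [c] or [- c] at [j]. Their values differ by
    [4 c n], where [n] is the sum to bound, and both lie within [c (c^2 + n)] of zero. *)
Lemma qform_bounded_column : 0 < c -> \sum_(i <- s) S i j ^+ 2 <= c ^+ 2.
Proof.
move=> c0; set n := \sum_(i <- s) _.
have nE : \sum_(i <- s) S i j * S i j = n by apply: eq_bigr => i _; rewrite expr2.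
have := S_bnd (fun i => if i == j then c else S i j).
have := S_bnd (fun i => if i == j then - c else S i j).
rewrite !(@qform_update j s S (fun i => S i j))// !(@sum_update j s (fun i => S i j))//.
rewrite nE -/n sqrrN !ler_norml => /andP[h1 _] /andP[_ h2].
rewrite -(ler_pM2l c0); nra.
Qed.

(** The Schur form at [v] is the maximum over [t] of the old form at [v] extended by [t], minus
    [t^2 / 2]. The old bound costs an extra [c t^2], which [t^2 / 2] absorbs; the lower bound holds
    because the added square is nonnegative. *)
Lemma qform_bounded_schur : c <= 1 / 4 -> qform_bounded s (schur S j) c.
Proof.
move=> c4 v; rewrite qform_schur.
set l := \sum_(i <- s) _.
have /andP[_ Sjj] : - c <= S j j <= c by rewrite -ler_norml qform_bounded_diag.
have a0 : 0 < 1 - 2 * S j j by lra.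
have := qform_bounded_tail v; rewrite !ler_norml => /andP[lo _]; apply/andP; split.
  apply: (le_trans lo); rewrite lerDl.
  by apply: divr_ge0; [rewrite mulr_ge0 ?sqr_ge0|exact: ltW].
(* The extension at which the maximum is attained. *)
pose t := 2 * l / (1 - 2 * S j j).
have := S_bnd (fun i => if i == j then t else v i).
rewrite qform_update// sum_update// -/l ler_norml => /andP[_ up].
have tE : 2 * l ^+ 2 / (1 - 2 * S j j) = t * l by rewrite /t; ring.
have lE : l = (1 - 2 * S j j) * t / 2 by rewrite /t; field; rewrite gt_eqF.
rewrite tE; move: up; rewrite {1 2}lE; have := sqr_ge0 t; nra.
Qed.

End elimination.

End quadratic_forms.

(** After squaring, [1 + x <= expR x] reduces this to [(1 + 2 a + 6 a^2) (1 - 2 a) >= 1], that is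
    [2 a^2 >= 12 a^3], true up to [a = 1 / 6]. With 2 in place of 3 the term in [a^2] would vanish
    and the inequality would fail. *)
Lemma inv_sqrt_le_expR (R : realType) (a : R) : 0 <= a <= 1 / 8 ->
  (Num.sqrt (1 - 2 * a))^-1 <= expR (a + 3 * a ^+ 2).
Proof.
move=> /andP[a0 a8]; have c0 : 0 < 1 - 2 * a by lra.
have sc0 : 0 < Num.sqrt (1 - 2 * a) by rewrite sqrtr_gt0.
rewrite -(ler_pM2r sc0) mulVf ?gt_eqF//.
have E0 : 0 <= expR (a + 3 * a ^+ 2) * Num.sqrt (1 - 2 * a).
  by rewrite mulr_ge0 ?expR_ge0// ltW.
rewrite -(@ler_pXn2r _ 2)// ?nnegrE ?ler01// expr1n exprMn sqr_sqrtr ?(ltW c0)//.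
rewrite -expRM_natl.
apply: (@le_trans _ _ ((1 + 2%:R * (a + 3 * a ^+ 2)) * (1 - 2 * a))); first nra.
by rewrite ler_pM2r// expR_ge1Dx.
Qed.

Section trace_frobenius.
Context (R : realType) (I : eqType).

Definition qtrace (s : seq I) (S : I -> I -> R) : R := \sum_(i <- s) S i i.
Definition fro2 (s : seq I) (S : I -> I -> R) : R :=
  \sum_(i <- s) \sum_(k <- s) S i k ^+ 2.

Lemma fro2_cons j s (S : I -> I -> R) : is_symmetric S ->
  fro2 (j :: s) S = S j j ^+ 2 + 2 * (\sum_(i <- s) S i j ^+ 2) + fro2 s S.
Proof.
move=> symS; rewrite /fro2 !big_cons.
under [X in _ + X = _]eq_bigr do rewrite big_cons.
rewrite big_split/= (eq_bigr (fun k => S k j ^+ 2)) => [|k _]; last by rewrite symS.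
by ring.
Qed.

Lemma fro2_schur j s (S : I -> I -> R) :
  fro2 s (schur S j) = fro2 s S +
    4 / (1 - 2 * S j j) * qform s S (fun i => S i j) +
    4 / (1 - 2 * S j j) ^+ 2 * (\sum_(i <- s) S i j ^+ 2) ^+ 2.
Proof.
rewrite /fro2 /qform (expr2 (\sum_(i <- s) _)) mulr_suml !mulr_sumr -!big_split/=.
apply: eq_bigr => i _; rewrite !mulr_sumr -!big_split/=.
by apply: eq_bigr => k _; rewrite /schur -exprVn; ring.
Qed.

Lemma qtrace_schur j s (S : I -> I -> R) :
  qtrace s (schur S j) = qtrace s S +
    2 / (1 - 2 * S j j) * \sum_(i <- s) S i j ^+ 2.
Proof.
rewrite /qtrace mulr_sumr -big_split/=; apply: eq_bigr => i _.
by rewrite /schur; ring.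
Qed.

(** With [n] the squared norm of the eliminated column and [e = 1 / (1 - 2 S j j)], dropping row and
    column [j] frees [6 n], while the Schur correction costs [2 e n + 12 e q + 12 e^2 n^2]. The
    bound 1/8 gives [e <= 4 / 3], [q <= n / 8] and [n <= 1 / 64], so the cost is at most [5 n]. *)
Lemma schur_potential j s (S : I -> I -> R) :
  is_symmetric S -> j \notin s -> 0 <= S j j -> qform_bounded (j :: s) S (1 / 8) ->
  S j j + 3 * S j j ^+ 2 + (qtrace s (schur S j) + 3 * fro2 s (schur S j)) <=
  qtrace (j :: s) S + 3 * fro2 (j :: s) S.
Proof.
move=> symS js Sjj0 bndS.
have /andP[_ Sjj8] : - (1 / 8) <= S j j <= 1 / 8.
  by rewrite -ler_norml (qform_bounded_diag symS js).
have col : \sum_(i <- s) S i j ^+ 2 <= (1 / 8) ^+ 2.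
  by apply: (qform_bounded_column symS js) => //; lra.
have := qform_bounded_tail symS js bndS (fun i => S i j).
rewrite ler_norml => /andP[_ qn].
rewrite fro2_cons// fro2_schur qtrace_schur [in leRHS]/qtrace big_cons -/(qtrace s S).
set q := qform s S _ in qn *; set n := \sum_(i <- s) _ in qn col *.
have n0 : 0 <= n by apply: sumr_ge0 => i _; exact: sqr_ge0.
set e := (1 - 2 * S j j)^-1.
have e0 : 0 <= e by rewrite invr_ge0; lra.
have eE : e <= 4 / 3 by rewrite /e -[leRHS]invrK lef_pV2 ?posrE; lra.
rewrite -exprVn -/e.
have eq : e * q <= 1 / 6 * n.
  have : e * q <= e * (1 / 8 * n) by rewrite ler_wpM2l.
  have : 0 <= (4 / 3 - e) * n by rewrite mulr_ge0// subr_ge0.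
  by lra.
have en : e * n <= 4 / 3 * n by rewrite ler_wpM2r.
have een : e ^+ 2 * n ^+ 2 <= 1 / 36 * n.
  have en0 : 0 <= e * n by rewrite mulr_ge0.
  have : (e * n) ^+ 2 <= (4 / 3 * n) ^+ 2 by rewrite !expr2 ler_pM.
  have : 0 <= n * ((1 / 8) ^+ 2 - n) by rewrite mulr_ge0// subr_ge0.
  by rewrite exprMn; nra.
lra.
Qed.

End trace_frobenius.

Section chaos.
Context d (Omega : measurableType d) (R : realType) (P : probability Omega R).
Context (I : finType) (X : I -> Omega -> R).
Hypothesis mX : forall i, measurable_fun setT (X i).
Hypothesis indepX : mutually_independent P X.
Hypothesis subX : forall i, mgf_le_gaussian P (X i).

Lemma measurable_qform d' (T : measurableType d') (s : seq I) S (Y : I -> T -> R) :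
  {in s, forall i, measurable_fun setT (Y i)} ->
  measurable_fun setT (fun w => qform s S (Y^~ w)).
Proof.
move=> mY; apply: measurable_sum_in => i si; apply: measurable_sum_in => k sk.
by apply: measurable_funM => //; apply: measurable_funM; exact: mY.
Qed.

(* One coordinate at a time: conditionally on the others the exponent is a
   quadratic polynomial in [X j], and integrating [X j] out replaces the form by
   a Schur complement, which satisfies the same hypotheses. *)
Lemma integral_expR_qform_le (s : seq I) S : uniq s -> is_symmetric S ->
  {in s, forall i, 0 <= S i i} -> qform_bounded s S (1 / 8) ->
  (\int[P]_w (expR (qform s S (X^~ w)))%:E <=
   (expR (qtrace s S + 3 * fro2 s S))%:E)%E.
Proof.
elim: s S => [S _ _ _ _|j s IHs S /= /andP[js us] symS diagS bndS].
  rewrite /qtrace /fro2 /qform; under eq_integral do rewrite big_nil expR0.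
  by rewrite !big_nil mulr0 addr0 expR0 integral_cst// mul1e [leLHS]probability_setT.
have Sjj0 : 0 <= S j j by apply: diagS; rewrite mem_head.
have /andP[_ Sjj8] : - (1 / 8) <= S j j <= 1 / 8.
  by rewrite -ler_norml (qform_bounded_diag symS js).
have c0 : 0 < 1 - 2 * S j j by lra.
pose l T (Y : I -> T -> R) (w : T) := \sum_(i <- s) S i j * Y i w.
have ml d' (T : measurableType d') (Y : I -> T -> R) :
    {in s, forall i, measurable_fun setT (Y i)} -> measurable_fun setT (l _ Y).
  move=> mY; apply: measurable_sum_in => i si.
  by apply: measurable_funM => //; exact: mY.
under eq_integral do rewrite qform_cons//.
pose Y i (z : others X j * R) := X i z.1.
have mY : {in s, forall i, measurable_fun setT (Y i)}.
  move=> i si; apply: measurableT_comp; last exact: measurable_fst.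
  by apply: measurable_others; apply: contraNneq js => <-.
have := @integral_others_le _ _ _ P _ _ mX indepX j
  (fun z => expR (S j j * z.2 ^+ 2 + 2 * z.2 * l _ Y z + qform s S (Y^~ z)))
  (fun w => (Num.sqrt (1 - 2 * S j j))^-1 * expR (qform s (schur S j) (X^~ w))).
move=> le_schur; apply: (le_trans (le_schur _ _ _ _)).
- apply: measurableT_comp => //; apply: measurable_funD; last exact: measurable_qform.
  apply: measurable_funD; first by apply: measurable_funM => //; exact: measurable_funX.
  by apply: measurable_funM; [exact: measurable_funM|exact: ml].
- by move=> z; exact: expR_ge0.
- apply: measurable_funM => //; apply: measurableT_comp => //.
  by apply: measurable_qform => i _; exact: mX.
- move=> w; set b := 2 * \sum_(i <- s) S i j * X i w.
  rewrite (_ : \int[P]_v _ = (expR (qform s S (X^~ w)))%:E *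
    \int[P]_v (expR (S j j * X j v ^+ 2 + b * X j v))%:E)%E; last first.
    rewrite -integral_scale ?expR_ge0//; last first.
      apply: measurableT_comp => //; apply: measurable_funD.
        by apply: measurable_funM => //; exact: measurable_funX.
      exact: measurable_funM.
    apply: eq_integral => v _; rewrite -expRD; congr (expR _)%:E.
    by rewrite /b /l /Y /=; ring.
  apply: (@le_trans _ _ ((expR (qform s S (X^~ w)))%:E *
    ((Num.sqrt (1 - 2 * S j j))^-1 * expR (b ^+ 2 / (2 * (1 - 2 * S j j))))%:E)%E).
    rewrite lee_wpmul2l ?lee_fin ?expR_ge0//; apply: quadratic_mgf_le => //.
    by rewrite Sjj0; lra.
  rewrite -EFinM lee_fin mulrCA -expRD qform_schur.
  rewrite (_ : b ^+ 2 / _ = 2 * (\sum_(i <- s) S i j * X i w) ^+ 2 / (1 - 2 * S j j))//.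
  by rewrite /b; field; rewrite gt_eqF.
- have mq : measurable_fun setT (fun w => qform s (schur S j) (X^~ w)).
    by apply: measurable_qform => i _; exact: mX.
  rewrite integral_scale//; last exact: measurableT_comp.
  have IH := IHs (schur S j) us (@schur_sym _ _ _ j symS) _ _.
  apply: (@le_trans _ _ ((Num.sqrt (1 - 2 * S j j))^-1%:E *
      (expR (qtrace s (schur S j) + 3 * fro2 s (schur S j)))%:E)%E).
    rewrite lee_wpmul2l ?lee_fin ?invr_ge0//; apply: IH.
    + move=> i si; rewrite addr_ge0//; first by apply: diagS; rewrite inE si orbT.
      by apply: divr_ge0; [rewrite -mulrA mulr_ge0// -expr2 sqr_ge0|exact: ltW].
    + by apply: qform_bounded_schur symS js bndS _; lra.
  rewrite -EFinM lee_fin.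
  apply: (@le_trans _ _ (expR (S j j + 3 * S j j ^+ 2) *
      expR (qtrace s (schur S j) + 3 * fro2 s (schur S j)))).
    by rewrite ler_wpM2r ?expR_ge0// inv_sqrt_le_expR// Sjj0.
  by rewrite -expRD ler_expR schur_potential.
Qed.

End chaos.

(** * Squares of sub-Gaussian variables and sums of independent terms *)

(** Everything follows from [1 - y <= expR (- y)]: for [y >= 0] it gives [expR y <= 1 + y expR y],
    to be iterated once, and for [y < 0] it gives [expR y <= 1 / (1 - y) <= 1 + y + y^2]. *)
Lemma expR_taylor2_le (R : realType) (y : R) :
  expR y <= 1 + y + y ^+ 2 * expR `|y|.
Proof.
have [y0|y0] := leP 0 y.
  have e0 : 0 < expR y by exact: expR_gt0.
  have : (1 - y) * expR y <= 1.
    by rewrite -[leRHS](expRxMexpNx_1 y) mulrC ler_pM2l// expR_ge1Dx.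
  by rewrite ger0_norm//; nra.
have z0 : 0 < 1 - y by lra.
have : expR y * (1 - y) <= 1.
  by rewrite -[leRHS](expRxMexpNx_1 y) ler_pM2l ?expR_gt0// expR_ge1Dx.
have : 1 <= expR `|y| by rewrite -expR0 ler_expR.
move: (expR `|y|) (expR y) => a b a1 b1.
apply: (@le_trans _ _ (1 + y + y ^+ 2)); last by have := sqr_ge0 y; nra.
by rewrite -(ler_pM2r z0); apply: (le_trans b1); have := sqr_ge0 y; nra.
Qed.

Section subgaussian_variable.
Context d (Omega : measurableType d) (R : realType) (P : probability Omega R).
Variable X : Omega -> R.
Hypothesis mX : measurable_fun setT X.
Hypothesis subX : mgf_le_gaussian P X.

(** Gaussian mixing at [a = 1 / 4] gives [sqrt 2]. This moment dominates the Taylor remainders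
    below. *)
Lemma integral_expR_sqr_le :
  (\int[P]_w (expR (X w ^+ 2 / 4))%:E <= (3 / 2)%:E)%E.
Proof.
have := @quadratic_mgf_le _ _ _ P X (1 / 4) 0 mX subX.
have -> : (0 <= 1 / 4 :> R) && (1 / 4 < 1 / 2 :> R) by lra.
move=> /(_ isT); under eq_integral do rewrite mul0r addr0 mulrC mul1r.
move=> /le_trans; apply; rewrite lee_fin expr0n/= mul0r expR0 mulr1.
have -> : 1 - 2 * (1 / 4) = 2^-1 :> R by field.
rewrite sqrtrV// invrK -[leRHS]ger0_norm// -sqrtr_sqr ler_wsqrtr//; lra.
Qed.

Lemma integrable_sqr : P.-integrable setT (fun w => (X w ^+ 2)%:E).
Proof.
apply: (@le_integrable _ _ _ _ _ measurableT _
  (fun w => (4 * expR (X w ^+ 2 / 4))%:E)).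
- by apply/measurable_EFinP; exact: measurable_funX.
- move=> w _; rewrite !abse_EFin lee_fin !ger0_norm ?sqr_ge0//.
  by have := expR_ge1Dx (X w ^+ 2 / 4); lra.
- apply/integrableP; split.
    apply/measurable_EFinP; apply: measurable_funM => //.
    by apply: measurableT_comp => //; apply: measurable_funM => //; exact: measurable_funX.
  under eq_integral do rewrite abse_EFin ger0_norm ?mulr_ge0 ?expR_ge0//.
  rewrite integral_scale//.
    by rewrite lte_mul_pinfty// (le_lt_trans integral_expR_sqr_le)// ltry.
  by apply: measurableT_comp => //; apply: measurable_funM => //; exact: measurable_funX.
Qed.

Lemma integrable_subgaussian : P.-integrable setT (EFin \o X).
Proof.
apply: (@le_integrable _ _ _ _ _ measurableT _ ((cst 1%:E) \+ (fun w => (X w ^+ 2)%:E))%E).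
- exact/measurable_EFinP.
- move=> w _; rewrite /= !lee_fin [leRHS]ger0_norm ?addr_ge0 ?sqr_ge0//.
  by rewrite -(real_normK (num_real (X w))); have := normr_ge0 (X w); nra.
- apply: integrableD => //; last exact: integrable_sqr.
  exact: finite_measure_integrable_cst.
Qed.

Definition second_moment : R := fine (\int[P]_w (X w ^+ 2)%:E)%E.

Lemma second_momentE : (\int[P]_w (X w ^+ 2)%:E = second_moment%:E)%E.
Proof. by rewrite fineK//; apply: integrable_fin_num => //; exact: integrable_sqr. Qed.

Lemma second_moment_ge0 : 0 <= second_moment.
Proof. by apply/fine_ge0/integral_ge0 => w _; rewrite lee_fin sqr_ge0. Qed.

Lemma integral_cstD (c : R) (f : Omega -> R) : 0 <= c ->
  measurable_fun setT f -> (forall w, 0 <= f w) ->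
  (\int[P]_w (c + f w)%:E = c%:E + \int[P]_w (f w)%:E)%E.
Proof.
move=> c0 mf f0; under eq_integral do rewrite EFinD.
rewrite ge0_integralD//.
- rewrite integral_cst//; congr (_ + _)%E.
  by rewrite -[RHS]mule1; congr (_ * _)%E; exact: probability_setT.
- by move=> w _; rewrite lee_fin.
- exact/measurable_EFinP.
Qed.

Lemma integral_addR (f g : Omega -> R) :
  measurable_fun setT f -> (forall w, 0 <= f w) ->
  measurable_fun setT g -> (forall w, 0 <= g w) ->
  (\int[P]_w (f w + g w)%:E = \int[P]_w (f w)%:E + \int[P]_w (g w)%:E)%E.
Proof.
move=> mf f0 mg g0; under eq_integral do rewrite EFinD.
rewrite ge0_integralD//.
- by move=> w _; rewrite lee_fin.
- exact/measurable_EFinP.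
- by move=> w _; rewrite lee_fin.
- exact/measurable_EFinP.
Qed.

(** Comparing [1 + a X^2] with its exponential gives [1 + a s <= expR (a + 3 a^2)] for the second
    moment [s]; a small [a] then rules out [s > 1]. *)
Lemma second_moment_le1 : second_moment <= 1.
Proof.
have bnd a : 0 < a -> a <= 1 / 8 -> second_moment * (1 - 4 * a) <= 1 + 3 * a.
  move=> a0 a8.
  have aX0 w : 0 <= a * X w ^+ 2 by apply: mulr_ge0; [exact: ltW|exact: sqr_ge0].
  have : (\int[P]_w (1 + a * X w ^+ 2)%:E <= (expR (a + 3 * a ^+ 2))%:E)%E.
    apply: (@le_trans _ _ (\int[P]_w (expR (a * X w ^+ 2 + 0 * X w))%:E)%E).
      apply: ge0_le_integral => //.
      - by move=> w _; rewrite lee_fin addr_ge0.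
      - apply/measurable_EFinP; apply: measurable_funD => //.
        by apply: measurable_funM => //; exact: measurable_funX.
      - apply/measurable_EFinP; apply: measurableT_comp => //.
        apply: measurable_funD; last exact: measurable_funM.
        by apply: measurable_funM => //; exact: measurable_funX.
      - by move=> w _; rewrite lee_fin mul0r addr0 expR_ge1Dx.
    apply: (le_trans (quadratic_mgf_le 0 mX subX _)); first by rewrite (ltW a0); lra.
    rewrite lee_fin expr0n/= mul0r expR0 mulr1 inv_sqrt_le_expR// (ltW a0)//.
  rewrite integral_cstD//; last first.
    by apply: measurable_funM => //; exact: measurable_funX.
  rewrite integral_scale ?(ltW a0)//; last 2 first.
  - exact: measurable_funX.
  - by move=> w; exact: sqr_ge0.
  rewrite second_momentE -EFinM -EFinD lee_fin.
  have := expR_ge1Dx (- (a + 3 * a ^+ 2)).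
  have := expRxMexpNx_1 (a + 3 * a ^+ 2).
  have := expR_gt0 (a + 3 * a ^+ 2).
  move: (expR (a + _)) (expR (- _)) => p q p0 pq q1 sp.
  have h : p * (1 - a - 3 * a ^+ 2) <= 1 by nra.
  have h2 : (1 + a * second_moment) * (1 - a - 3 * a ^+ 2) <= 1.
    by apply: le_trans h; rewrite ler_wpM2r//; nra.
  rewrite -(ler_pM2l a0); have := second_moment_ge0; nra.
rewrite leNgt; apply/negP => s1.
have := second_moment_ge0; set s := second_moment in s1 bnd * => s0.
have c0 : 0 < 3 + 4 * s by lra.
(* [bnd] is an equality at [a = (s - 1) / (3 + 4 s)] and fails below it; half of that value is
   taken. *)
pose a := Num.min (1 / 8) ((s - 1) / (2 * (3 + 4 * s))).
have a0 : 0 < a.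
  by rewrite lt_min; apply/andP; split; [lra|rewrite divr_gt0 ?subr_gt0 ?mulr_gt0].
have a8 : a <= 1 / 8 by rewrite ge_min lexx.
have a2 : a * (2 * (3 + 4 * s)) <= s - 1.
  by rewrite -ler_pdivlMr ?mulr_gt0// ge_min lexx orbT.
by have := bnd a a0 a8; nra.
Qed.

(** [u = x^2 + 1] dominates [|x^2 - second_moment|]. Of the exponent [u / 4 - 2], the part
    [3 u / 16 - 2] absorbs [u^2] and [u / 16] bounds [|y|]; what remains is the constant
    [1024 / 9 * expR (- (7 / 4)) < 33]. *)
Lemma centered_sqr_remainder (a x : R) : `|a| <= 1 / 16 ->
  (a * (x ^+ 2 - second_moment)) ^+ 2 * expR `|a * (x ^+ 2 - second_moment)| <=
  33 * a ^+ 2 * expR (x ^+ 2 / 4).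
Proof.
move=> a16; set y := a * _; set u := x ^+ 2 + 1.
have x20 := sqr_ge0 x; have s0 := second_moment_ge0; have s1 := second_moment_le1.
have u0 : 0 <= u by rewrite /u; lra.
have xu : `|x ^+ 2 - second_moment| <= u by rewrite ler_norml /u; apply/andP; split; lra.
(* The square of [z <= expR (z - 1)] at [z = 3 u / 32]. *)
have u2 : u ^+ 2 <= 1024 / 9 * expR (3 / 16 * u - 2).
  have -> : 3 / 16 * u - 2 = 2%:R * (3 / 32 * u - 1) by field.
  rewrite expRM_natl.
  have -> : 1024 / 9 = (32 / 3) ^+ 2 :> R by field.
  rewrite -exprMn ler_pXn2r ?nnegrE ?mulr_ge0 ?expR_ge0//.
  by have := expR_ge1Dx (3 / 32 * u - 1); lra.
have ey : expR `|y| <= expR (u / 16).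
  rewrite ler_expR normrM; apply: (@le_trans _ _ (1 / 16 * u)); last by lra.
  by rewrite ler_pM.
have y2 : y ^+ 2 <= a ^+ 2 * u ^+ 2.
  rewrite exprMn ler_wpM2l ?sqr_ge0//.
  by rewrite -(real_normK (num_real (x ^+ 2 - _))) !expr2 ler_pM.
have e74 : expR (- (7 / 4)) <= 64 / 225 :> R.
  have h : 15 / 8 <= expR (7 / 8) :> R by have := expR_ge1Dx (7 / 8 : R); lra.
  rewrite expRN -[leRHS]invrK lef_pV2 ?posrE ?expR_gt0//.
  have -> : (64 / 225)^-1 = 225 / 64 :> R by field.
  have -> : 7 / 4 = 2%:R * (7 / 8) :> R by field.
  by rewrite expRM_natl; nra.
apply: (@le_trans _ _ (a ^+ 2 * (1024 / 9 * expR (3 / 16 * u - 2)) * expR (u / 16))).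
  apply: ler_pM => //; rewrite ?expR_ge0 ?sqr_ge0//.
  by apply: (le_trans y2); rewrite ler_wpM2l ?sqr_ge0.
have -> : a ^+ 2 * (1024 / 9 * expR (3 / 16 * u - 2)) * expR (u / 16) =
    a ^+ 2 * (1024 / 9 * (expR (3 / 16 * u - 2) * expR (u / 16))) by ring.
rewrite -expRD (_ : 3 / 16 * u - 2 + u / 16 = - (7 / 4) + x ^+ 2 / 4).
  have e33 : 0 <= 33 - 1024 / 9 * expR (- (7 / 4)) :> R by lra.
  have b0 : 0 <= a ^+ 2 * expR (x ^+ 2 / 4) by rewrite mulr_ge0 ?sqr_ge0 ?expR_ge0.
  by rewrite expRD; have := mulr_ge0 e33 b0; lra.
by rewrite /u; field.
Qed.

(** In the integrated Taylor bound the linear term has mean zero and the remainder contributes at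
    most [33 * 3 / 2 * a^2], below [52 a^2]. *)
Lemma centered_sqr_mgf_le (a : R) : `|a| <= 1 / 16 ->
  (\int[P]_w (expR (a * (X w ^+ 2 - second_moment)))%:E <=
   (expR (52 * a ^+ 2))%:E)%E.
Proof.
move=> a16; set s := second_moment.
have s0 : 0 <= s := second_moment_ge0.
have mX2 : measurable_fun setT (fun w => X w ^+ 2) by exact: measurable_funX.
have mexp4 : measurable_fun setT (fun w => expR (X w ^+ 2 / 4)).
  by apply: measurableT_comp => //; exact: measurable_funM.
pose y w := a * (X w ^+ 2 - s).
have mexpy : measurable_fun setT (fun w => expR (y w)).
  by apply: measurableT_comp => //; apply: measurable_funM => //; exact: measurable_funB.
have X20 w : 0 <= X w ^+ 2 := sqr_ge0 (X w).
(* Splitting [a] by sign lets negative terms change sides in [le_pt], so that only nonnegative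
   functions are integrated. *)
pose p := Num.max a 0; pose n := Num.max (- a) 0.
have p0 : 0 <= p by rewrite le_max lexx orbT.
have n0 : 0 <= n by rewrite le_max lexx orbT.
have aE : a = p - n.
  rewrite /p /n; case: (leP a 0) => ?; case: (leP (- a) 0) => ?; lra.
pose g w := 33 * a ^+ 2 * expR (X w ^+ 2 / 4).
have a33 : 0 <= 33 * a ^+ 2 by rewrite mulr_ge0 ?sqr_ge0.
have g0 w : 0 <= g w by rewrite mulr_ge0 ?expR_ge0.
have mg : measurable_fun setT g by exact: measurable_funM.
have pX0 w : 0 <= p * X w ^+ 2 by rewrite mulr_ge0.
have nX0 w : 0 <= n * X w ^+ 2 by rewrite mulr_ge0.
have ps0 : 0 <= p * s by rewrite mulr_ge0.
have ns0 : 0 <= n * s by rewrite mulr_ge0.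
have mpX : measurable_fun setT (fun w => p * X w ^+ 2) by exact: measurable_funM.
have mnX : measurable_fun setT (fun w => n * X w ^+ 2) by exact: measurable_funM.
have le_pt w : p * s + (n * X w ^+ 2 + expR (y w)) <=
    1 + n * s + (p * X w ^+ 2 + g w).
  have h1 := expR_taylor2_le (y w).
  have h2 := centered_sqr_remainder (X w) a16.
  have yE : y w = (p - n) * (X w ^+ 2 - s) by rewrite /y -aE.
  have := le_trans h1 (lerD (lexx _) h2); rewrite -/(g w) {2}yE; lra.
have : (\int[P]_w (p * s + (n * X w ^+ 2 + expR (y w)))%:E <=
    \int[P]_w (1 + n * s + (p * X w ^+ 2 + g w))%:E)%E.
  apply: ge0_le_integral => //.
  - by move=> w _; rewrite lee_fin !addr_ge0 ?expR_ge0.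
  - by apply/measurable_EFinP; do 2 apply: measurable_funD => //.
  - by apply/measurable_EFinP; do 2 apply: measurable_funD => //.
  - by move=> w _; rewrite lee_fin.
rewrite !integral_cstD//; last 5 first.
- by rewrite addr_ge0.
- by apply: measurable_funD.
- by move=> w; rewrite addr_ge0.
- by apply: measurable_funD.
- by move=> w; rewrite addr_ge0 ?expR_ge0.
have ey0 w : 0 <= expR (y w) by exact: expR_ge0.
rewrite (integral_addR mnX nX0 mexpy ey0) (integral_addR mpX pX0 mg g0).
rewrite (integral_scale P n0 mX2 X20) (integral_scale P p0 mX2 X20) second_momentE -/s.
rewrite (integral_scale P a33 mexp4 (fun w => expR_ge0 _)).
have := integral_expR_sqr_le.
have : (0 <= \int[P]_w (expR (X w ^+ 2 / 4))%:E)%E.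
  by apply: integral_ge0 => w _; rewrite lee_fin expR_ge0.
case: (\int[P]_w (expR (X w ^+ 2 / 4))%:E)%E => [r| |]// _.
rewrite lee_fin -!EFinM -!EFinD => r32.
change (\int[P]_w (expR (a * (X w ^+ 2 - s)))%:E)%E with (\int[P]_w (expR (y w))%:E)%E.
case: (\int[P]_w (expR (y w))%:E)%E => [t| |]//; last by move=> _; rewrite leNye.
rewrite -!EFinD !lee_fin => h; apply: le_trans (expR_ge1Dx _).
have : 33 * a ^+ 2 * r <= 33 * a ^+ 2 * (3 / 2) by rewrite ler_wpM2l.
by have := sqr_ge0 a; lra.
Qed.

End subgaussian_variable.

Section second_moment_sum.
Context d (Omega : measurableType d) (R : realType) (P : probability Omega R).
Context (I : finType) (X : I -> Omega -> R).
Hypothesis mX : forall i, measurable_fun setT (X i).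
Hypothesis indepX : mutually_independent P X.
Hypothesis subX : forall i, mgf_le_gaussian P (X i).
Hypothesis meanX : forall i, (\int[P]_w (X i w)%:E = 0)%E.

Lemma integral_shift_sqr i (y c : R) :
  (\int[P]_w ((y + c * X i w) ^+ 2)%:E =
   (y ^+ 2 + c ^+ 2 * second_moment P (X i))%:E)%E.
Proof.
have intX := integrable_subgaussian (@mX i) (@subX i).
have intX2 := integrable_sqr (@mX i) (@subX i).
transitivity (\int[P]_w ((y ^+ 2)%:E +
    ((2 * y * c)%:E * (X i w)%:E + (c ^+ 2)%:E * (X i w ^+ 2)%:E)))%E.
  by apply: eq_integral => w _; rewrite -!EFinM -!EFinD; congr EFin; ring.
rewrite integralD//.
- rewrite integralD//; [|exact: integrableZl|exact: integrableZl].
  rewrite !integralZl// (meanX i) mule0 add0e (second_momentE (@mX i) (@subX i)).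
  rewrite integral_cst// [X in (_ * X)%E]probability_setT mule1.
  by rewrite -EFinM -EFinD.
- exact: finite_measure_integrable_cst.
- by apply: integrableD => //; exact: integrableZl.
Qed.

(** Additivity of variance; it turns the unit variance of the fading into an identity for the rows
    of its matrix. *)
Lemma integral_sum_sqr (s : seq I) (c : I -> R) : uniq s ->
  (\int[P]_w ((\sum_(i <- s) c i * X i w) ^+ 2)%:E =
   (\sum_(i <- s) c i ^+ 2 * second_moment P (X i))%:E)%E.
Proof.
elim: s => [_|j s IHs /= /andP[js us]].
  by under eq_integral do rewrite big_nil expr0n/=; rewrite big_nil integral0.
have msum d' (T : measurableType d') (Y : I -> T -> R) :
    {in s, forall i, measurable_fun setT (Y i)} ->
    measurable_fun setT (fun w => \sum_(i <- s) c i * Y i w).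
  move=> mY; apply: measurable_sum_in => i si.
  by apply: measurable_funM => //; exact: mY.
transitivity (\int[P]_w
    ((\sum_(i <- s) c i * X i w) ^+ 2 + c j ^+ 2 * second_moment P (X j))%:E)%E.
  under eq_integral do rewrite big_cons addrC.
  have := @integral_others _ _ _ P _ _ mX indepX j
    (fun z => (\sum_(i <- s) c i * X i z.1 + c j * z.2) ^+ 2).
  move=> /= ->.
  - by apply: eq_integral => w _; rewrite integral_shift_sqr.
  - apply: measurable_funX; apply: measurable_funD; last exact: measurable_funM.
    pose Y i (w : others X j * R) := X i w.1.
    apply: (msum _ _ Y) => i si; apply: measurableT_comp; last exact: measurable_fst.
    by apply: measurable_others; apply: contraNneq js => <-.
  - by move=> z; exact: sqr_ge0.
under eq_integral do rewrite addrC.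
rewrite integral_cstD; first by rewrite IHs// -EFinD big_cons.
- by rewrite mulr_ge0 ?sqr_ge0// second_moment_ge0.
- by apply: measurable_funX; apply: msum => i _; exact: mX.
- by move=> w; exact: sqr_ge0.
Qed.

Lemma integral_expR_sum_le (s : seq I) (c : I -> R) : uniq s ->
  (\int[P]_w (expR (\sum_(i <- s) c i * X i w))%:E <=
   (expR (\sum_(i <- s) c i ^+ 2 / 2))%:E)%E.
Proof.
move=> us; rewrite expR_sum; under eq_integral do rewrite expR_sum.
apply: (integral_prod_le mX indepX (h := fun i x => expR (c i * x))) => //.
- by move=> i; apply: measurableT_comp => //; exact: measurable_funM.
- by move=> i; exact: subX.
Qed.

Lemma integral_expR_diag_le (s : seq I) (a : I -> R) : uniq s ->
  (forall i, `|a i| <= 1 / 16) ->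
  (\int[P]_w (expR (\sum_(i <- s) a i * (X i w ^+ 2 - second_moment P (X i))))%:E <=
   (expR (\sum_(i <- s) 52 * a i ^+ 2))%:E)%E.
Proof.
move=> us a16; rewrite expR_sum; under eq_integral do rewrite expR_sum.
apply: (integral_prod_le mX indepX
  (h := fun i x => expR (a i * (x ^+ 2 - second_moment P (X i))))) => //.
- move=> i; apply: measurableT_comp => //; apply: measurable_funM => //.
  by apply: measurable_funB => //; exact: measurable_funX.
- by move=> i; exact: centered_sqr_mgf_le.
Qed.

End second_moment_sum.

(** * Euclidean inequalities for finite sums *)

Section finite_sums.
Context (R : realType).

(** Lagrange's identity: the difference is half the sum of the squared minors
    [x i * y k - x k * y i]. *)
Lemma CauchySchwarz_sum (I : finType) (x y : I -> R) :
  (\sum_i x i * y i) ^+ 2 <= (\sum_i x i ^+ 2) * (\sum_i y i ^+ 2).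
Proof.
rewrite -subr_ge0.
have -> : (\sum_i x i ^+ 2) * (\sum_i y i ^+ 2) - (\sum_i x i * y i) ^+ 2 =
    2^-1 * \sum_i \sum_k (x i * y k - x k * y i) ^+ 2.
  rewrite (_ : \sum_i \sum_k _ = \sum_i \sum_k (x i ^+ 2 * y k ^+ 2) +
      \sum_i \sum_k (x k ^+ 2 * y i ^+ 2) -
      2 * \sum_i \sum_k ((x i * y i) * (x k * y k))).
    rewrite [X in _ + X - _]exchange_big/=.
    by rewrite -!big_distrlr/= expr2; field.
  rewrite mulr_sumr -!big_split -sumrB/=; apply: eq_bigr => i _.
  by rewrite mulr_sumr -!big_split -sumrB/=; apply: eq_bigr => k _; ring.
by rewrite mulr_ge0 ?invr_ge0// sumr_ge0// => i _; rewrite sumr_ge0// => k _; exact: sqr_ge0.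
Qed.

Lemma Minkowski_sum (I : finType) (x y : I -> R) (p q : R) : 0 <= p -> 0 <= q ->
  \sum_i x i ^+ 2 <= p ^+ 2 -> \sum_i y i ^+ 2 <= q ^+ 2 ->
  \sum_i (x i + y i) ^+ 2 <= (p + q) ^+ 2.
Proof.
move=> p0 q0 xp yq.
have xy : \sum_i x i * y i <= p * q.
  have [|xy0] := leP (\sum_i x i * y i) 0; first by move/le_trans; apply; exact: mulr_ge0.
  rewrite -(@ler_pXn2r _ 2)// ?nnegrE ?mulr_ge0 ?(ltW xy0)// exprMn.
  apply: (le_trans (CauchySchwarz_sum x y)).
  by apply: ler_pM => //; apply: sumr_ge0 => i _; exact: sqr_ge0.
have -> : \sum_i (x i + y i) ^+ 2 =
    \sum_i x i ^+ 2 + 2 * (\sum_i x i * y i) + \sum_i y i ^+ 2.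
  by rewrite mulr_sumr -!big_split/=; apply: eq_bigr => i _; ring.
by rewrite sqrrD; lra.
Qed.

(** With [z] the image of [y] under the transpose, [|z|^4 = <y, G z>^2 <= |y|^2 w |z|^2], and
    [|z|^2] cancels. *)
Lemma transpose_bounded (I J : finType) (G : I -> J -> R) (w : R) : 0 <= w ->
  (forall v : J -> R, \sum_i (\sum_j G i j * v j) ^+ 2 <= w * \sum_j v j ^+ 2) ->
  forall y : I -> R, \sum_j (\sum_i G i j * y i) ^+ 2 <= w * \sum_i y i ^+ 2.
Proof.
move=> w0 bG y; pose z j := \sum_i G i j * y i.
rewrite -/(\sum_j z j ^+ 2); set n := \sum_j z j ^+ 2.
have nE : n = \sum_i y i * \sum_j G i j * z j.
  rewrite (eq_bigr (fun i => \sum_j y i * (G i j * z j))) => [|i _]; last by rewrite mulr_sumr.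
  rewrite exchange_big/=; apply: eq_bigr => j _; rewrite expr2 {1}/z mulr_suml.
  by apply: eq_bigr => i _; ring.
have n0 : 0 <= n by apply: sumr_ge0 => j _; exact: sqr_ge0.
have y0 : 0 <= \sum_i y i ^+ 2 by apply: sumr_ge0 => i _; exact: sqr_ge0.
have : n ^+ 2 <= (\sum_i y i ^+ 2) * (w * n).
  rewrite {1}nE; apply: (le_trans (CauchySchwarz_sum _ _)).
  by rewrite ler_wpM2l// bG.
have [->|nn0] := eqVneq n 0; first by rewrite mulr_ge0.
have np : 0 < n by rewrite lt_neqAle eq_sym nn0.
by move=> h; rewrite -(ler_pM2r np); move: h; rewrite expr2; lra.
Qed.

End finite_sums.

(** * Gram matrices *)

Section gram.
Context (R : realType) (B J : finType) (G : B -> J -> R) (W : R).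
Hypothesis W0 : 0 <= W.
Hypothesis G_bnd :
  forall v : J -> R, \sum_b (\sum_j G b j * v j) ^+ 2 <= W * \sum_j v j ^+ 2.

Definition gram i k : R := \sum_b G b i * G b k.

Lemma gram_sym : is_symmetric gram.
Proof. by move=> i k; apply: eq_bigr => b _; rewrite mulrC. Qed.

Lemma gram_qform (v : J -> R) :
  qform (index_enum J) gram v = \sum_b (\sum_j G b j * v j) ^+ 2.
Proof.
rewrite /qform.
under eq_bigr => i _ do under eq_bigr => k _ do rewrite mulr_suml.
under eq_bigr => i _ do rewrite exchange_big/=.
rewrite exchange_big/=; apply: eq_bigr => b _.
rewrite expr2 mulr_suml; apply: eq_bigr => i _.
by rewrite mulr_sumr; apply: eq_bigr => k _; ring.
Qed.

Lemma gram_diag j : gram j j = \sum_b G b j ^+ 2.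
Proof. by apply: eq_bigr => b _; rewrite expr2. Qed.

Lemma gram_diag_ge0 j : 0 <= gram j j.
Proof. by rewrite gram_diag; apply: sumr_ge0 => b _; exact: sqr_ge0. Qed.

Lemma gram_diag_le j : gram j j <= W.
Proof.
have one : \sum_k (k == j)%:R ^+ 2 = 1 :> R.
  by rewrite (bigD1 j)//= eqxx expr1n big1 ?addr0// => k /negbTE->; rewrite expr0n.
have := G_bnd (fun k => (k == j)%:R); rewrite one mulr1.
move=> /(le_trans _); apply; rewrite gram_diag ler_sum// => b _.
rewrite [leRHS](_ : _ = G b j ^+ 2)//; congr (_ ^+ 2).
by rewrite (bigD1 j)//= eqxx mulr1 big1 ?addr0// => k /negbTE->; rewrite mulr0.
Qed.

(** Column [k] of the Gram matrix is the transpose of [G] applied to column [k] of [G]. *)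
Lemma gram_fro : fro2 (index_enum J) gram <= W * \sum_b \sum_j G b j ^+ 2.
Proof.
rewrite /fro2 exchange_big/= [X in _ <= W * X]exchange_big mulr_sumr.
by apply: ler_sum => k _; exact: (transpose_bounded W0 G_bnd).
Qed.

Definition offdiag (t : R) i k : R := if i == k then 0 else t * gram i k.

Lemma offdiag_sym t : is_symmetric (offdiag t).
Proof. by move=> i k; rewrite /offdiag eq_sym gram_sym. Qed.

Lemma offdiag_qform t (v : J -> R) : qform (index_enum J) (offdiag t) v =
  t * (\sum_b (\sum_j G b j * v j) ^+ 2 - \sum_j gram j j * v j ^+ 2).
Proof.
rewrite -gram_qform /qform -sumrB mulr_sumr; apply: eq_bigr => i _.
rewrite mulrBr mulr_sumr (bigD1 i)//= [in RHS](bigD1 i)//= /offdiag eqxx mul0r add0r.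
rewrite expr2 addrAC subrr add0r; apply: eq_bigr => k; rewrite eq_sym => /negbTE->.
by ring.
Qed.

(** The Gram form and its diagonal part both lie between 0 and [W |v|^2], so removing the diagonal
    costs no factor 2. *)
Lemma offdiag_bounded t : qform_bounded (index_enum J) (offdiag t) (`|t| * W).
Proof.
move=> v; rewrite offdiag_qform normrM -mulrA ler_wpM2l// ler_norml.
have v0 : 0 <= \sum_b (\sum_j G b j * v j) ^+ 2.
  by apply: sumr_ge0 => b _; exact: sqr_ge0.
have d0 : 0 <= \sum_j gram j j * v j ^+ 2.
  by apply: sumr_ge0 => j _; rewrite mulr_ge0 ?gram_diag_ge0 ?sqr_ge0.
have dW : \sum_j gram j j * v j ^+ 2 <= W * \sum_j v j ^+ 2.
  by rewrite mulr_sumr; apply: ler_sum => j _; rewrite ler_wpM2r ?sqr_ge0 ?gram_diag_le.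
by have gv := G_bnd v; apply/andP; split; lra.
Qed.

Lemma offdiag_fro t : fro2 (index_enum J) (offdiag t) <=
  t ^+ 2 * (W * \sum_b \sum_j G b j ^+ 2).
Proof.
apply: (@le_trans _ _ (t ^+ 2 * fro2 (index_enum J) gram)); last first.
  by rewrite ler_wpM2l ?sqr_ge0 ?gram_fro.
rewrite /fro2 mulr_sumr; apply: ler_sum => i _; rewrite mulr_sumr; apply: ler_sum => k _.
rewrite /offdiag; case: eqP => _; last by rewrite exprMn.
by rewrite expr0n mulr_ge0 ?sqr_ge0.
Qed.

Lemma gram_diag_sqr : \sum_j gram j j ^+ 2 <= W * \sum_b \sum_j G b j ^+ 2.
Proof.
apply: le_trans gram_fro; rewrite /fro2; apply: ler_sum => j _.
by rewrite (bigD1 j)//= lerDl; apply: sumr_ge0 => k _; exact: sqr_ge0.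
Qed.

End gram.

Section gram_concentration.
Context d (Omega : measurableType d) (R : realType) (P : probability Omega R).
Context (B J : finType) (G : B -> J -> R) (W : R).
Hypothesis W0 : 0 <= W.
Hypothesis G_bnd :
  forall v : J -> R, \sum_b (\sum_j G b j * v j) ^+ 2 <= W * \sum_j v j ^+ 2.
Context (X : J -> Omega -> R).
Hypothesis mX : forall i, measurable_fun setT (X i).
Hypothesis indepX : mutually_independent P X.
Hypothesis subX : forall i, mgf_le_gaussian P (X i).

(** With the trace equal to zero no term linear in [t] appears, and both signs of [t] are
    covered. *)
Lemma offdiag_mgf_le t : `|t| * W <= 1 / 8 ->
  (\int[P]_w (expR (t * (\sum_b (\sum_j G b j * X j w) ^+ 2 -
      \sum_j gram G j j * X j w ^+ 2)))%:E <=
   (expR (3 * (t ^+ 2 * (W * \sum_b \sum_j G b j ^+ 2))))%:E)%E.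
Proof.
move=> tW; under eq_integral do rewrite -(offdiag_qform G t (X^~ _)).
apply: (le_trans (integral_expR_qform_le mX indepX subX _ _ _ _)).
- exact: index_enum_uniq.
- exact: offdiag_sym.
- by move=> i _; rewrite /offdiag eqxx.
- move=> v; apply: (le_trans (offdiag_bounded G_bnd t v)).
  by rewrite ler_wpM2r//; apply: sumr_ge0 => j _; exact: sqr_ge0.
- rewrite lee_fin ler_expR /qtrace big1 ?add0r => [|j _]; last by rewrite /offdiag eqxx.
  by rewrite ler_wpM2l// offdiag_fro.
Qed.

(** Cauchy-Schwarz for dependent [f] and [g], as [a b <= ((x a)^2 + (y b)^2) / 2] with [x y = 1];
    the weights in [F] and [H] make the two resulting bounds equal. *)
Lemma expR_average_le (f g : Omega -> R) (p q : R) :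
  measurable_fun setT f -> measurable_fun setT g ->
  (\int[P]_w (expR (2 * f w))%:E <= (expR p)%:E)%E ->
  (\int[P]_w (expR (2 * g w))%:E <= (expR q)%:E)%E ->
  (\int[P]_w (expR (f w + g w))%:E <= (expR ((p + q) / 2))%:E)%E.
Proof.
move=> mf mg fp gq.
pose F w := expR ((q - p) / 2) / 2 * expR (2 * f w).
pose H w := expR ((p - q) / 2) / 2 * expR (2 * g w).
have mef : measurable_fun setT (fun w => expR (2 * f w)).
  by apply: measurableT_comp => //; exact: measurable_funM.
have meg : measurable_fun setT (fun w => expR (2 * g w)).
  by apply: measurableT_comp => //; exact: measurable_funM.
have c0 x : 0 <= expR x / 2 :> R by rewrite divr_ge0 ?expR_ge0.
apply: (@le_trans _ _ (\int[P]_w (F w + H w)%:E)%E).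
  apply: ge0_le_integral => //.
  - by apply/measurable_EFinP; apply: measurableT_comp => //; exact: measurable_funD.
  - by apply/measurable_EFinP; apply: measurable_funD; exact: measurable_funM.
  - move=> w _; rewrite lee_fin /F /H.
    have -> : expR (2 * f w) = expR (f w) ^+ 2 by rewrite -expRM_natl.
    have -> : expR (2 * g w) = expR (g w) ^+ 2 by rewrite -expRM_natl.
    have : expR ((q - p) / 4) * expR ((p - q) / 4) = 1 :> R.
      by rewrite -expRD -expR0; congr expR; field.
    have -> : expR ((q - p) / 2) = expR ((q - p) / 4) ^+ 2 :> R.
      by rewrite -expRM_natl; congr expR; field.
    have -> : expR ((p - q) / 2) = expR ((p - q) / 4) ^+ 2 :> R.
      by rewrite -expRM_natl; congr expR; field.
    rewrite expRD; set a := expR (f w); set b := expR (g w).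
    set x := expR _; set y := expR _ => xy1.
    have -> : a * b = (x * a) * (y * b) by rewrite mulrACA xy1 mul1r.
    by have := sqr_ge0 (x * a - y * b); lra.
rewrite integral_addR//; last 4 first.
- exact: measurable_funM.
- by move=> w; rewrite mulr_ge0 ?expR_ge0.
- exact: measurable_funM.
- by move=> w; rewrite mulr_ge0 ?expR_ge0.
rewrite !integral_scale// ?expR_ge0//.
apply: (@le_trans _ _ ((expR ((q - p) / 2) / 2)%:E * (expR p)%:E +
    (expR ((p - q) / 2) / 2)%:E * (expR q)%:E)%E).
  by apply: leeD; rewrite lee_wpmul2l ?lee_fin.
rewrite -!EFinM -EFinD lee_fin mulrAC -expRD [X in _ + X]mulrAC -expRD.
rewrite (_ : (q - p) / 2 + p = (p + q) / 2); last by field.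
by rewrite (_ : (p - q) / 2 + q = (p + q) / 2); [lra|field].
Qed.

End gram_concentration.

Lemma sum_prodE (V : nmodType) (I J : finType) (F : I * J -> V) :
  \sum_q F q = \sum_i \sum_j F (i, j).
Proof. by rewrite pair_bigA; apply: eq_bigr => -[]. Qed.

(** * Superposition of the signals *)

Section superposition.
Context (R : realType) (Mt Kt J : finType).
Context (A : Mt * bool -> Kt -> J -> R) (B : Mt * bool -> J -> R).
Context (al : Kt -> R) (be : R) (sg : J -> R) (a b aF bF p : R).
Hypotheses (a0 : 0 <= a) (b0 : 0 <= b) (aF0 : 0 <= aF) (bF0 : 0 <= bF).
Hypotheses (p0 : 0 <= p) (be0 : 0 <= be).
Hypothesis al_le : \sum_k al k ^+ 2 <= p ^+ 2.
Hypothesis sg_bnd : forall j, 0 <= sg j <= 1.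
Hypothesis A_op : forall v : J -> R,
  \sum_c \sum_k (\sum_j A c k j * v j) ^+ 2 <= a ^+ 2 * \sum_j v j ^+ 2.
Hypothesis B_op : forall v : J -> R,
  \sum_c (\sum_j B c j * v j) ^+ 2 <= b ^+ 2 * \sum_j v j ^+ 2.
Hypothesis A_fro : \sum_c \sum_k \sum_j A c k j ^+ 2 <= aF ^+ 2.
Hypothesis B_fro : \sum_c \sum_j B c j ^+ 2 <= bF ^+ 2.

Let W := (p * a + be * b) ^+ 2.
Let V := W * (p * aF + be * bF) ^+ 2.

(* The matrix [G] with [y = G r], where [y] is the scaled receive vector and
   [H = A r], [N = B r]. *)
Definition received (u : Mt * Kt -> R) (c : Mt * bool) (j : J) : R :=
  \sum_k al k * u (c.1, k) * A c k j + be * B c j.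

Section signs.
Variable u : Mt * Kt -> R.
Hypothesis u2 : forall i, u i ^+ 2 = 1.

Lemma signal_le (c : Mt * bool) (x : Kt -> R) :
  (\sum_k al k * u (c.1, k) * x k) ^+ 2 <= p ^+ 2 * \sum_k x k ^+ 2.
Proof.
apply: (le_trans (CauchySchwarz_sum _ _)).
apply: ler_wpM2r; first by apply: sumr_ge0 => k _; exact: sqr_ge0.
by under eq_bigr do rewrite exprMn u2 mulr1.
Qed.

(** Triangle inequality for fading and noise. In every real coordinate the users are combined with a
    coefficient vector of norm at most [p], whatever the signs; hence [p * a]. *)
Lemma received_bounded (v : J -> R) :
  \sum_c (\sum_j received u c j * v j) ^+ 2 <= W * \sum_j v j ^+ 2.
Proof.
have v0 : 0 <= \sum_j v j ^+ 2 by apply: sumr_ge0 => j _; exact: sqr_ge0.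
set n := Num.sqrt (\sum_j v j ^+ 2).
have n0 : 0 <= n by rewrite sqrtr_ge0.
have nE : n ^+ 2 = \sum_j v j ^+ 2 by rewrite sqr_sqrtr.
have -> : W * \sum_j v j ^+ 2 = (p * a * n + be * b * n) ^+ 2.
  by rewrite -nE /W; ring.
have recvE c : \sum_j received u c j * v j =
    \sum_k al k * u (c.1, k) * (\sum_j A c k j * v j) +
    be * \sum_j B c j * v j.
  under [X in X + _]eq_bigr do rewrite mulr_sumr.
  rewrite exchange_big/= mulr_sumr -big_split/=; apply: eq_bigr => j _.
  rewrite /received mulrDl mulr_suml; congr (_ + _); last by rewrite mulrA.
  by apply: eq_bigr => k _; rewrite mulrA.
under eq_bigr do rewrite recvE.
apply: Minkowski_sum; rewrite ?mulr_ge0//.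
- apply: (@le_trans _ _ (\sum_c p ^+ 2 * \sum_k (\sum_j A c k j * v j) ^+ 2)).
    by apply: ler_sum => c _; exact: signal_le.
  rewrite -mulr_sumr -mulrA !exprMn nE ler_wpM2l ?sqr_ge0//; exact: A_op.
- under eq_bigr do rewrite exprMn.
  by rewrite -mulr_sumr -mulrA !exprMn nE ler_wpM2l ?sqr_ge0//; exact: B_op.
Qed.

Lemma received_fro :
  \sum_c \sum_j received u c j ^+ 2 <= (p * aF + be * bF) ^+ 2.
Proof.
rewrite pair_bigA/=; apply: Minkowski_sum; rewrite ?mulr_ge0//.
- rewrite -(pair_bigA _ (fun c j => (\sum_k al k * u (c.1, k) * A c k j) ^+ 2))/=.
  apply: (@le_trans _ _ (\sum_c \sum_j p ^+ 2 * \sum_k A c k j ^+ 2)).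
    by apply: ler_sum => c _; apply: ler_sum => j _; exact: signal_le.
  under eq_bigr do rewrite -mulr_sumr exchange_big/=.
  by rewrite -mulr_sumr exprMn ler_wpM2l ?sqr_ge0.
- rewrite -(pair_bigA _ (fun c j => (be * B c j) ^+ 2))/=.
  under eq_bigr => c _ do under eq_bigr do rewrite exprMn.
  under eq_bigr do rewrite -mulr_sumr.
  by rewrite -mulr_sumr exprMn ler_wpM2l ?sqr_ge0.
Qed.

End signs.

(* The quadratic form in the signs [u] that is the part of [E |y|^2] due to the
   fading alone. *)
Definition signal_mx (q : (Mt * bool) * J) (i : Mt * Kt) : R :=
  if q.1.1 == i.1 then Num.sqrt (sg q.2) * (al i.2 * A q.1 i.2 q.2) else 0.

(** With [sg] the second moments, twice the covariance of the scaled noise in use [i.1] with the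
    scaled fading of user [i.2], summed over real and imaginary parts. *)
Definition signal_noise (i : Mt * Kt) : R :=
  2 * al i.2 * be * \sum_(s : bool) \sum_j A (i.1, s) i.2 j * (sg j * B (i.1, s) j).

Lemma signal_mx_sum (q : (Mt * bool) * J) (v : Mt * Kt -> R) :
  \sum_i signal_mx q i * v i =
  Num.sqrt (sg q.2) * \sum_k A q.1 k q.2 * (al k * v (q.1.1, k)).
Proof.
rewrite sum_prodE (bigD1 q.1.1)//= [X in _ + X]big1 ?addr0; last first.
  move=> m mq; rewrite big1// => k _.
  by rewrite /signal_mx/= eq_sym (negbTE mq) mul0r.
rewrite mulr_sumr; apply: eq_bigr => k _.
by rewrite /signal_mx/= eqxx; ring.
Qed.

Lemma A_block_bounded c (z : Kt -> R) :
  \sum_j (\sum_k A c k j * z k) ^+ 2 <= a ^+ 2 * \sum_k z k ^+ 2.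
Proof.
apply: transpose_bounded; first exact: sqr_ge0.
move=> v; apply: le_trans (A_op v); rewrite [leRHS](bigD1 c)//= lerDl.
by apply: sumr_ge0 => c' _; apply: sumr_ge0 => k _; exact: sqr_ge0.
Qed.

Lemma al_le1 k : al k ^+ 2 <= p ^+ 2.
Proof.
apply: le_trans al_le; rewrite (bigD1 k)//= lerDl.
by apply: sumr_ge0 => k' _; exact: sqr_ge0.
Qed.

(** Each channel use has signs of its own, so its rows see no others and the bound does not add up
    over the uses. The factor 2 counts the real and the imaginary coordinate that share these
    signs. *)
Lemma signal_mx_bounded (v : Mt * Kt -> R) :
  \sum_q (\sum_i signal_mx q i * v i) ^+ 2 <=
  (2 * (p * a) ^+ 2) * \sum_i v i ^+ 2.
Proof.
have rowE q : (\sum_i signal_mx q i * v i) ^+ 2 =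
    sg q.2 * (\sum_k A q.1 k q.2 * (al k * v (q.1.1, k))) ^+ 2.
  by rewrite signal_mx_sum exprMn sqr_sqrtr//; have /andP[] := sg_bnd q.2.
under eq_bigr do rewrite rowE.
rewrite -(pair_bigA _ (fun c j => sg j *
  (\sum_k A c k j * (al k * v (c.1, k))) ^+ 2))/=.
apply: (@le_trans _ _ (\sum_(c : Mt * bool) (p * a) ^+ 2 * \sum_k v (c.1, k) ^+ 2)).
  apply: ler_sum => c _.
  apply: (@le_trans _ _ (\sum_j (\sum_k A c k j * (al k * v (c.1, k))) ^+ 2)).
    apply: ler_sum => j _; have /andP[_ sg1] := sg_bnd j.
    by rewrite ler_piMl ?sqr_ge0.
  apply: (le_trans (A_block_bounded _ _)).
  rewrite exprMn (mulrC (p ^+ 2)) -(mulrA (a ^+ 2)) ler_wpM2l ?sqr_ge0// mulr_sumr.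
  by apply: ler_sum => k _; rewrite exprMn ler_wpM2r ?sqr_ge0 ?al_le1.
rewrite -mulr_sumr (mulrC 2) -(mulrA ((p * a) ^+ 2)) ler_wpM2l ?sqr_ge0//.
rewrite sum_prodE/=.
rewrite [X in _ <= _ * X]sum_prodE.
rewrite mulr_sumr; apply: ler_sum => m _; rewrite big_bool/=; lra.
Qed.

Lemma signal_mx_fro :
  \sum_q \sum_i signal_mx q i ^+ 2 <= (p * aF) ^+ 2.
Proof.
have rowE q : \sum_i signal_mx q i ^+ 2 = sg q.2 * \sum_k (al k * A q.1 k q.2) ^+ 2.
  rewrite sum_prodE (bigD1 q.1.1)//= [X in _ + X]big1 ?addr0; last first.
    move=> m mq; rewrite big1// => k _.
    by rewrite /signal_mx/= eq_sym (negbTE mq) expr0n.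
  rewrite mulr_sumr; apply: eq_bigr => k _; rewrite /signal_mx/= eqxx exprMn.
  by rewrite sqr_sqrtr//; have /andP[] := sg_bnd q.2.
under eq_bigr do rewrite rowE.
rewrite -(pair_bigA _ (fun c j => sg j * \sum_k (al k * A c k j) ^+ 2))/=.
apply: (@le_trans _ _ (\sum_c \sum_j p ^+ 2 * \sum_k A c k j ^+ 2)).
  apply: ler_sum => c _; apply: ler_sum => j _; have /andP[_ sg1] := sg_bnd j.
  apply: (@le_trans _ _ (\sum_k (al k * A c k j) ^+ 2)).
    by rewrite ler_piMl// sumr_ge0// => k _; exact: sqr_ge0.
  rewrite mulr_sumr; apply: ler_sum => k _.
  by rewrite exprMn ler_wpM2r ?sqr_ge0 ?al_le1.
under eq_bigr do rewrite -mulr_sumr exchange_big/=.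
by rewrite -mulr_sumr exprMn ler_wpM2l ?sqr_ge0.
Qed.

(** Fading enters through its operator norm, noise through its Frobenius norm. The 8 is the squared
    factor 2 of [signal_noise] times the 2 of [(x + y)^2 <= 2 (x^2 + y^2)]. *)
Lemma signal_noise_le :
  \sum_i signal_noise i ^+ 2 <= 8 * ((p * a) ^+ 2 * (be * bF) ^+ 2).
Proof.
pose g c k := \sum_j A c k j * (sg j * B c j).
have gE : \sum_c \sum_k g c k ^+ 2 <= a ^+ 2 * bF ^+ 2.
  apply: (@le_trans _ _ (\sum_c a ^+ 2 * \sum_j B c j ^+ 2)); last first.
    by rewrite -mulr_sumr ler_wpM2l ?sqr_ge0.
  apply: ler_sum => c _.
  apply: (@le_trans _ _ (a ^+ 2 * \sum_j (sg j * B c j) ^+ 2)).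
    apply: le_trans (A_op _); rewrite [leRHS](bigD1 c)//= lerDl.
    by apply: sumr_ge0 => c' _; apply: sumr_ge0 => k _; exact: sqr_ge0.
  rewrite ler_wpM2l ?sqr_ge0//; apply: ler_sum => j _.
  have /andP[sg0 sg1] := sg_bnd j.
  by rewrite exprMn ler_piMl ?sqr_ge0// expr_le1.
apply: (@le_trans _ _ (\sum_c \sum_k 8 * (p ^+ 2 * be ^+ 2) * g c k ^+ 2)); last first.
  under eq_bigr do rewrite -mulr_sumr.
  have h : 0 <= p ^+ 2 * be ^+ 2 by rewrite mulr_ge0 ?sqr_ge0.
  by rewrite -mulr_sumr; have := ler_wpM2l h gE; rewrite !exprMn; lra.
rewrite [leLHS]sum_prodE [leRHS]sum_prodE.
apply: ler_sum => m _; rewrite exchange_big/=; apply: ler_sum => k _.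
rewrite /signal_noise/= !big_bool/= -/(g (m, true) k) -/(g (m, false) k).
set x := g _ _; set y := g _ _.
have h : 0 <= be ^+ 2 * (x ^+ 2 + y ^+ 2) by rewrite mulr_ge0 ?sqr_ge0 ?addr_ge0 ?sqr_ge0.
apply: (@le_trans _ _ (8 * al k ^+ 2 * (be ^+ 2 * (x ^+ 2 + y ^+ 2)))).
  have : 0 <= (al k * be * (x - y)) ^+ 2 by exact: sqr_ge0.
  by lra.
by have := ler_wpM2r h (al_le1 k); lra.
Qed.

Hypothesis A_var : forall c k, \sum_j sg j * A c k j ^+ 2 = 1.

Definition estimation_error (u : Mt * Kt -> R) (r : J -> R) : R :=
  \sum_c (\sum_j received u c j * r j) ^+ 2 -
  be ^+ 2 * (\sum_c \sum_j sg j * B c j ^+ 2) -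
  (2 * #|Mt|)%:R * \sum_k al k ^+ 2.

(** Unit variance and unit signs make the diagonal of the chaos in the signs a constant: the signal
    energy to be estimated. *)
Lemma gram_signal_diag (u : Mt * Kt -> R) : (forall i, u i ^+ 2 = 1) ->
  \sum_i gram signal_mx i i * u i ^+ 2 = (2 * #|Mt|)%:R * \sum_k al k ^+ 2.
Proof.
move=> u2; under eq_bigr do rewrite u2 mulr1 gram_diag.
rewrite sum_prodE/=.
rewrite (_ : (2 * #|Mt|)%:R * \sum_k al k ^+ 2 = \sum_(m : Mt) 2 * \sum_k al k ^+ 2); last first.
  by rewrite sumr_const -[RHS]mulr_natl natrM -mulrA mulrCA.
apply: eq_bigr => m _; rewrite mulr_sumr; apply: eq_bigr => k _.
rewrite sum_prodE/= (sum_prodE (fun c => \sum_j signal_mx (c, j) (m, k) ^+ 2)).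
rewrite (bigD1 m)//= [X in _ + X]big1 ?addr0; last first.
  move=> m' mm'; rewrite big1// => s _; rewrite big1// => j _.
  by rewrite /signal_mx/= (negbTE mm') expr0n.
rewrite big_bool/= /signal_mx/= eqxx.
have E s : \sum_j (Num.sqrt (sg j) * (al k * A (m, s) k j)) ^+ 2 = al k ^+ 2.
  rewrite -[RHS]mulr1 -(A_var (m, s) k) mulr_sumr; apply: eq_bigr => j _.
  have /andP[sg0 _] := sg_bnd j.
  by rewrite exprMn (sqr_sqrtr sg0) exprMn mulrCA.
by rewrite !E; ring.
Qed.

(** For independent centred coordinates with second moments [sg], the sum of
    [gram (received u) j j * sg j] is the mean energy given the signs; its expansion consists of the
    noise energy, the chaos in the signs and the covariance term. *)
Lemma estimation_errorE (u : Mt * Kt -> R) (r : J -> R) : (forall i, u i ^+ 2 = 1) ->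
  estimation_error u r =
  (\sum_c (\sum_j received u c j * r j) ^+ 2 -
     \sum_j gram (received u) j j * r j ^+ 2) +
  \sum_j gram (received u) j j * (r j ^+ 2 - sg j) +
  ((\sum_q (\sum_i signal_mx q i * u i) ^+ 2 - \sum_i gram signal_mx i i * u i ^+ 2) +
   \sum_i signal_noise i * u i).
Proof.
move=> u2; rewrite gram_signal_diag// /estimation_error.
suff E : \sum_j gram (received u) j j * sg j =
    be ^+ 2 * (\sum_c \sum_j sg j * B c j ^+ 2) +
    \sum_q (\sum_i signal_mx q i * u i) ^+ 2 + \sum_i signal_noise i * u i.
  rewrite (_ : \sum_j gram (received u) j j * (r j ^+ 2 - sg j) =
      \sum_j gram (received u) j j * r j ^+ 2 - \sum_j gram (received u) j j * sg j).
    by rewrite E; ring.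
  by rewrite -sumrB; apply: eq_bigr => j _; rewrite mulrBr.
pose s c j := \sum_k al k * u (c.1, k) * A c k j.
rewrite (sum_prodE (fun q => (\sum_i signal_mx q i * u i) ^+ 2)).
have -> : \sum_c \sum_j (\sum_i signal_mx (c, j) i * u i) ^+ 2 =
    \sum_c \sum_j sg j * s c j ^+ 2.
  apply: eq_bigr => c _; apply: eq_bigr => j _; rewrite signal_mx_sum exprMn sqr_sqrtr/=.
    by congr (_ * _ ^+ 2); apply: eq_bigr => k _; ring.
  by have /andP[] := sg_bnd j.
have -> : \sum_i signal_noise i * u i = \sum_c \sum_j 2 * be * (sg j * s c j * B c j).
  rewrite [LHS]sum_prodE [RHS]sum_prodE/=; apply: eq_bigr => m _.
  rewrite (eq_bigr (fun k => \sum_(t : bool) \sum_j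
    2 * al k * be * (A (m, t) k j * (sg j * B (m, t) j)) * u (m, k))); last first.
    move=> k _; rewrite /signal_noise/= mulr_sumr mulr_suml; apply: eq_bigr => t _.
    by rewrite mulr_sumr mulr_suml.
  rewrite exchange_big/=; apply: eq_bigr => t _.
  rewrite exchange_big/=; apply: eq_bigr => j _.
  rewrite /s/= mulr_sumr mulr_suml mulr_sumr; apply: eq_bigr => k _; ring.
under eq_bigr do rewrite gram_diag mulr_suml.
rewrite exchange_big/= mulr_sumr -!big_split/=; apply: eq_bigr => c _.
rewrite mulr_sumr -!big_split/=; apply: eq_bigr => j _.
by rewrite /received -/(s c j); ring.
Qed.

End superposition.

(** * Exponential moment of the estimation error *)

Section error_mgf.
Context dU (OmegaU : measurableType dU) d (Omega : measurableType d) (R : realType).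
Context (PU : probability OmegaU R) (P : probability Omega R) (Mt Kt J : finType).
Context (X : J -> Omega -> R) (U : Mt * Kt -> OmegaU -> R).
Hypothesis mX : forall j, measurable_fun setT (X j).
Hypothesis indepX : mutually_independent P X.
Hypothesis subX : forall j, mgf_le_gaussian P (X j).
Hypothesis mU : forall i, measurable_fun setT (U i).
Hypothesis indepU : mutually_independent PU U.
Hypothesis subU : forall i, mgf_le_gaussian PU (U i).
Hypothesis U2 : forall i w, U i w ^+ 2 = 1.
Context (A : Mt * bool -> Kt -> J -> R) (B : Mt * bool -> J -> R).
Context (al : Kt -> R) (be : R) (a b aF bF p : R).
Hypotheses (a0 : 0 <= a) (b0 : 0 <= b) (aF0 : 0 <= aF) (bF0 : 0 <= bF).
Hypotheses (p0 : 0 <= p) (be0 : 0 <= be).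
Hypothesis al_le : \sum_k al k ^+ 2 <= p ^+ 2.
Hypothesis A_op : forall v : J -> R,
  \sum_c \sum_k (\sum_j A c k j * v j) ^+ 2 <= a ^+ 2 * \sum_j v j ^+ 2.
Hypothesis B_op : forall v : J -> R,
  \sum_c (\sum_j B c j * v j) ^+ 2 <= b ^+ 2 * \sum_j v j ^+ 2.
Hypothesis A_fro : \sum_c \sum_k \sum_j A c k j ^+ 2 <= aF ^+ 2.
Hypothesis B_fro : \sum_c \sum_j B c j ^+ 2 <= bF ^+ 2.

Let sg j := second_moment P (X j).
Hypothesis A_var : forall c k, \sum_j sg j * A c k j ^+ 2 = 1.

Let W := (p * a + be * b) ^+ 2.
Let V := W * (p * aF + be * bF) ^+ 2.
Let err v w := estimation_error A B al be sg (U^~ v) (X^~ w).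

Let sg_bnd j : 0 <= sg j <= 1.
Proof. by rewrite second_moment_ge0 (second_moment_le1 (@mX j) (@subX j)). Qed.

Let W0 : 0 <= W. Proof. exact: sqr_ge0. Qed.

Let paW : (p * a) ^+ 2 <= W.
Proof. by rewrite ler_pXn2r ?nnegrE ?addr_ge0 ?mulr_ge0// lerDl mulr_ge0. Qed.

Let pabF_le : (p * a) ^+ 2 * (be * bF) ^+ 2 <= V.
Proof.
rewrite ler_pM ?sqr_ge0//.
by rewrite ler_pXn2r ?nnegrE ?addr_ge0 ?mulr_ge0// lerDr mulr_ge0.
Qed.

Let paaF_le : (p * a) ^+ 2 * (p * aF) ^+ 2 <= V.
Proof.
rewrite ler_pM ?sqr_ge0//.
by rewrite ler_pXn2r ?nnegrE ?addr_ge0 ?mulr_ge0// lerDl mulr_ge0.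
Qed.

(** The conditional mean of the error given the signs. *)
Let offset (u : Mt * Kt -> R) : R :=
  (\sum_q (\sum_i signal_mx A al sg q i * u i) ^+ 2 -
     \sum_i gram (signal_mx A al sg) i i * u i ^+ 2) +
  \sum_i signal_noise A B al be sg i * u i.

(** 110 is the average of [12 = 3 * 2^2], from the off-diagonal part, and [208 = 52 * 2^2], from the
    diagonal part; the squares stem from doubling [t]. *)
Lemma error_mgf_fixed_signs v t : `|t| * W <= 1 / 32 ->
  (\int[P]_w (expR (t * err v w))%:E <=
   (expR (110 * (t ^+ 2 * V)) * expR (t * offset (U^~ v)))%:E)%E.
Proof.
move=> tW; set G := received A B al be (U^~ v).
have G_bnd := received_bounded a0 b0 p0 be0 al_le A_op B_op (u := U^~ v) (fun i => U2 i v).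
have G_fro := received_fro aF0 bF0 p0 be0 al_le A_fro B_fro (u := U^~ v) (fun i => U2 i v).
rewrite -/G -/W in G_bnd G_fro.
have WG : W * (\sum_c \sum_j G c j ^+ 2) <= V by rewrite ler_wpM2l.
pose f w := t * (\sum_c (\sum_j G c j * X j w) ^+ 2 - \sum_j gram G j j * X j w ^+ 2).
pose g w := \sum_j (t * gram G j j) * (X j w ^+ 2 - sg j).
have mXj j : measurable_fun setT (X j) := @mX j.
have mX2 j : measurable_fun setT (fun w => X j w ^+ 2) by exact: measurable_funX.
have mf : measurable_fun setT f.
  apply: measurable_funM => //; apply: measurable_funB.
    apply: measurable_sum => c; apply: measurable_funX; apply: measurable_sum => j.
    exact: measurable_funM.
  by apply: measurable_sum => j; exact: measurable_funM.
have mg : measurable_fun setT g.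
  by apply: measurable_sum => j; apply: measurable_funM => //; exact: measurable_funB.
have errE w : t * err v w = t * offset (U^~ v) + (f w + g w).
  rewrite /err (estimation_errorE B al be sg_bnd A_var) => [|i]; last exact: U2.
  rewrite -/G /f /g /offset [RHS]addrC [LHS]mulrDr; congr (_ + _).
  by rewrite mulrDr; congr (_ + _); rewrite mulr_sumr; apply: eq_bigr => j _; rewrite mulrA.
under eq_integral do rewrite errE expRD.
rewrite integral_scale ?expR_ge0//; last first.
  by apply: measurableT_comp => //; exact: measurable_funD.
rewrite EFinM [leRHS]muleC lee_wpmul2l ?lee_fin ?expR_ge0//.
have t2V : 0 <= t ^+ 2 * V by rewrite mulr_ge0 ?sqr_ge0// mulr_ge0 ?sqr_ge0.
have f_mgf : (\int[P]_w (expR (2 * f w))%:E <= (expR (12 * (t ^+ 2 * V)))%:E)%E.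
  under eq_integral do rewrite mulrA.
  apply: (le_trans (offdiag_mgf_le W0 G_bnd mX indepX subX _)).
    by rewrite normrM ger0_norm// -mulrA; lra.
  rewrite lee_fin ler_expR exprMn.
  by have := ler_wpM2l (sqr_ge0 t) WG; lra.
have g_mgf : (\int[P]_w (expR (2 * g w))%:E <= (expR (208 * (t ^+ 2 * V)))%:E)%E.
  pose cf j := 2 * t * gram G j j.
  rewrite (eq_integral (fun w => (expR (\sum_j cf j * (X j w ^+ 2 - sg j)))%:E)); last first.
    move=> w _; congr (expR _)%:E; rewrite /g mulr_sumr; apply: eq_bigr => j _.
    by rewrite /cf !mulrA.
  apply: (le_trans (integral_expR_diag_le mX indepX subX (index_enum_uniq J) _)).
    move=> j; rewrite /cf !normrM (ger0_norm (gram_diag_ge0 G j)) ger0_norm//.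
    by have := ler_wpM2l (normr_ge0 t) (gram_diag_le G_bnd j); lra.
  rewrite lee_fin ler_expR -mulr_sumr.
  have dV : \sum_j cf j ^+ 2 <= 4 * (t ^+ 2 * V).
    under eq_bigr do rewrite /cf exprMn exprMn.
    rewrite -mulr_sumr.
    have := ler_wpM2l (sqr_ge0 t) (le_trans (gram_diag_sqr W0 G_bnd) WG); lra.
  by lra.
apply: (le_trans (expR_average_le mf mg f_mgf g_mgf)).
by rewrite lee_fin ler_expR; lra.
Qed.

(** [4 |t| W <= 1 / 8] is what the chaos bound asks: one factor 2 is due to Cauchy-Schwarz, one to
    [signal_mx_bounded]. The chaos gives [24 = 3 * 4 * 2], the linear form [16 = 4 * 8 / 2], and 20
    is their average. *)
Lemma offset_mgf t : `|t| * W <= 1 / 32 ->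
  (\int[PU]_v (expR (t * offset (U^~ v)))%:E <= (expR (20 * (t ^+ 2 * V)))%:E)%E.
Proof.
move=> tW.
set Q := signal_mx A al sg; set z := signal_noise A B al be sg.
have Q_bnd : forall v : Mt * Kt -> R,
    \sum_q (\sum_i Q q i * v i) ^+ 2 <= (2 * (p * a) ^+ 2) * \sum_i v i ^+ 2.
  exact: (signal_mx_bounded al_le sg_bnd A_op).
have Q_fro : \sum_q \sum_i Q q i ^+ 2 <= (p * aF) ^+ 2.
  exact: (signal_mx_fro al_le sg_bnd A_fro).
have z_le : \sum_i z i ^+ 2 <= 8 * V.
  apply: (le_trans (signal_noise_le be al_le sg_bnd A_op B_fro)).
  by rewrite ler_wpM2l.
have paaQ : 2 * (p * a) ^+ 2 * (\sum_q \sum_i Q q i ^+ 2) <= 2 * V.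
  have h : 0 <= 2 * (p * a) ^+ 2 by rewrite mulr_ge0 ?sqr_ge0.
  by have := paaF_le; have := ler_wpM2l h Q_fro; lra.
have pa0 : 0 <= 2 * (p * a) ^+ 2 by rewrite mulr_ge0 ?sqr_ge0.
pose f v := t * (\sum_q (\sum_i Q q i * U i v) ^+ 2 - \sum_i gram Q i i * U i v ^+ 2).
pose g v := \sum_i (t * z i) * U i v.
have mUi i : measurable_fun setT (U i) := @mU i.
have mf : measurable_fun setT f.
  apply: measurable_funM => //; apply: measurable_funB.
    apply: measurable_sum => q; apply: measurable_funX; apply: measurable_sum => i.
    exact: measurable_funM.
  apply: measurable_sum => i; apply: measurable_funM => //; exact: measurable_funX.
have mg : measurable_fun setT g.
  by apply: measurable_sum => i; exact: measurable_funM.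
have f_mgf : (\int[PU]_v (expR (2 * f v))%:E <= (expR (24 * (t ^+ 2 * V)))%:E)%E.
  under eq_integral do rewrite mulrA.
  apply: (le_trans (offdiag_mgf_le pa0 Q_bnd mU indepU subU _)).
    by rewrite normrM ger0_norm//; have := ler_wpM2l (normr_ge0 t) paW; lra.
  rewrite lee_fin ler_expR exprMn.
  by have := ler_wpM2l (sqr_ge0 t) paaQ; lra.
have g_mgf : (\int[PU]_v (expR (2 * g v))%:E <= (expR (16 * (t ^+ 2 * V)))%:E)%E.
  pose cf i := 2 * t * z i.
  rewrite (eq_integral (fun v => (expR (\sum_i cf i * U i v))%:E)); last first.
    move=> v _; congr (expR _)%:E; rewrite /g mulr_sumr; apply: eq_bigr => i _.
    by rewrite /cf !mulrA.
  apply: (le_trans (integral_expR_sum_le mU indepU subU cf (index_enum_uniq _))).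
  rewrite lee_fin ler_expR -mulr_suml.
  have : \sum_i cf i ^+ 2 <= 32 * (t ^+ 2 * V).
    under eq_bigr do rewrite /cf exprMn exprMn.
    by rewrite -mulr_sumr; have := ler_wpM2l (sqr_ge0 t) z_le; lra.
  by lra.
rewrite (eq_integral (fun v => (expR (f v + g v))%:E)); last first.
  move=> v _; congr (expR _)%:E; rewrite /offset mulrDr; congr (_ + _).
  by rewrite mulr_sumr; apply: eq_bigr => i _; rewrite mulrA.
apply: (le_trans (expR_average_le mf mg f_mgf g_mgf)).
by rewrite lee_fin ler_expR; lra.
Qed.

Lemma measurable_error_mgf t :
  measurable_fun setT (fun v => (\int[P]_w (expR (t * err v w))%:E)%E).
Proof.
pose g (z : OmegaU * Omega) : \bar R := (expR (t * err z.1 z.2))%:E.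
have mg : measurable_fun setT g.
  apply/measurable_EFinP; apply: measurableT_comp => //; apply: measurable_funM => //.
  have mX2 j : measurable_fun setT (fun z : OmegaU * Omega => X j z.2).
    exact: (measurableT_comp (@mX j) measurable_snd).
  have mU1 i : measurable_fun setT (fun z : OmegaU * Omega => U i z.1).
    exact: (measurableT_comp (@mU i) measurable_fst).
  do 2 apply: measurable_funB => //.
  apply: measurable_sum => c; apply: measurable_funX; apply: measurable_sum => j.
  apply: measurable_funM => //; apply: measurable_funD => //.
  by apply: measurable_sum => k; do 2 apply: measurable_funM => //.
have g0 z : (0 <= g z)%E by rewrite lee_fin expR_ge0.
exact: (@measurable_fun_fubini_tonelli_F _ _ _ _ _ P _ mg g0).
Qed.

Lemma error_mgf t : `|t| * W <= 1 / 32 ->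
  (\int[PU]_v \int[P]_w (expR (t * err v w))%:E <=
   (expR (130 * (t ^+ 2 * V)))%:E)%E.
Proof.
move=> tW.
have moff : measurable_fun setT (fun v => expR (t * offset (U^~ v))).
  apply: measurableT_comp => //; apply: measurable_funM => //.
  have mUi i : measurable_fun setT (U i) := @mU i.
  apply: measurable_funD; last by apply: measurable_sum => i; exact: measurable_funM.
  apply: measurable_funB.
    apply: measurable_sum => q; apply: measurable_funX; apply: measurable_sum => i.
    exact: measurable_funM.
  apply: measurable_sum => i; apply: measurable_funM => //; exact: measurable_funX.
apply: (@le_trans _ _ (\int[PU]_v
    (expR (110 * (t ^+ 2 * V)) * expR (t * offset (U^~ v)))%:E)%E).
  apply: ge0_le_integral => //.
  - by move=> v _; apply: integral_ge0 => w _; rewrite lee_fin expR_ge0.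
  - exact: measurable_error_mgf.
  - by apply/measurable_EFinP; exact: measurable_funM.
  - by move=> v _; exact: error_mgf_fixed_signs.
rewrite integral_scale ?expR_ge0//.
apply: (@le_trans _ _ ((expR (110 * (t ^+ 2 * V)))%:E * (expR (20 * (t ^+ 2 * V)))%:E)%E).
  by rewrite lee_wpmul2l ?lee_fin ?expR_ge0// offset_mgf.
by rewrite -EFinM -expRD lee_fin ler_expR; lra.
Qed.

End error_mgf.

Lemma leq_exp2_fact (m : nat) : (2 ^ m * m`! <= m.*2`!)%N.
Proof.
elim: m => // m IHm; rewrite doubleS expnS !factS.
have -> : (2 * 2 ^ m * (m.+1 * m`!) = m.*2.+2 * (2 ^ m * m`!))%N.
  by rewrite -doubleS -mul2n mulnACA.
by rewrite leq_mul2l (leq_trans IHm) ?orbT// leq_pmull.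
Qed.

(** Termwise comparison of power series: odd terms cancel, and [x^(2m) / (2m)!] is at most
    [(x^2 / 2)^m / m!]. *)
Lemma cosh_le_expR (R : realType) (x : R) :
  (expR x + expR (- x)) / 2 <= expR (x ^+ 2 / 2).
Proof.
pose t := [sequence exp_coeff x n + exp_coeff (- x) n]_n.
have t_odd m : t m.*2.+1 = 0.
  by rewrite /t/= /exp_coeff/= exprNn -signr_odd/= odd_double expr1 mulN1r mulNr subrr.
have t_even m : t m.*2 <= 2 * exp_coeff (x ^+ 2 / 2) m.
  rewrite /t/= /exp_coeff/= exprNn -signr_odd/= odd_double expr0 mul1r.
  rewrite -mul2n exprM expr_div_n; set y := (x ^+ 2) ^+ m.
  have y0 : 0 <= y by rewrite exprn_ge0// sqr_ge0.
  have h : (2 ^+ m * m`!%:R : R) <= ((2 * m)`!)%:R.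
    by rewrite -natrX -natrM ler_nat mul2n leq_exp2_fact.
  have h0 : 0 < (2 ^+ m * m`!%:R : R) by rewrite mulr_gt0 ?exprn_gt0// ltr0n fact_gt0.
  have hi : ((2 * m)`!%:R)^-1 <= (2 ^+ m * m`!%:R : R)^-1.
    by rewrite lef_pV2// posrE// (lt_le_trans h0).
  by have := ler_wpM2l y0 hi; rewrite invfM; lra.
have tS m : series t m.*2 <= 2 * series (exp_coeff (x ^+ 2 / 2)) m.
  elim: m => [|m IHm]; first by rewrite /series/= !big_geq ?mulr0.
  rewrite doubleS /series/= !big_nat_recr//= t_odd addr0 mulrDr.
  by apply: lerD; [exact: IHm|exact: t_even].
have e0 n : 0 <= exp_coeff (x ^+ 2 / 2) n.
  by apply: exp_coeff_ge0; rewrite divr_ge0 ?sqr_ge0.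
have Sexp m : series (exp_coeff (x ^+ 2 / 2)) m <= expR (x ^+ 2 / 2).
  apply: nondecreasing_cvgn_le; last exact: is_cvg_series_exp_coeff.
  by apply/nondecreasing_seqP => n; rewrite /series/= big_nat_recr//= lerDl.
have t_bound m : series t m <= 2 * expR (x ^+ 2 / 2).
  (* A partial sum of odd length is completed by one more term, which has odd index and vanishes. *)
  have -> : m = (odd m + m./2.*2)%N by rewrite odd_double_half.
  case: (odd m) => /=; rewrite ?add0n ?add1n.
    apply: (@le_trans _ _ (series t (m./2.+1).*2)).
      rewrite doubleS /series/= big_nat_recr//= [leRHS]big_nat_recr//= big_nat_recr//=.
      by rewrite t_odd addr0.
    by apply: (le_trans (tS _)); rewrite ler_wpM2l.
  by apply: (le_trans (tS _)); rewrite ler_wpM2l.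
rewrite ler_pdivrMr// mulrC.
have tE : series t = series (exp_coeff x) \+ series (exp_coeff (- x)).
  by apply/funext => n; rewrite /series/= -big_split.
have cvg_t : series t n @[n --> \oo] --> expR x + expR (- x).
  by rewrite tE; apply: cvgD; exact: is_cvg_series_exp_coeff.
rewrite -(cvg_lim (@Rhausdorff R) cvg_t); apply: limr_le; first exact: (cvgP _ cvg_t).
by near=> n.
Unshelve. all: by end_near.
Qed.

(** * Random signs *)

Section random_signs.
Context (R : realType) (I : finType).
Let N := #|{ffun I -> bool}|.

Definition sign_code (n : nat) : {ffun I -> bool} :=
  nth [ffun=> false] (enum {ffun I -> bool}) n.

Definition random_sign (i : I) (n : nat) : R := if sign_code n i then 1 else -1.

Let N_gt0 : (0 < N)%N.
Proof. by apply/card_gt0P; exists [ffun=> false]. Qed.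

Let invN_ge0 : 0 <= (N%:R : R)^-1. Proof. by rewrite invr_ge0. Qed.

(* A uniform sign vector, coded by its rank in an enumeration; the ranks from
   [2 ^ #|I|] on are null. *)
Definition uniform_signs : set nat -> \bar R :=
  mscale (NngNum invN_ge0) (msum (fun n => \d_n) N).

HB.instance Definition _ := Measure.on uniform_signs.

Lemma integral_signs (F : {ffun I -> bool} -> R) : (forall g, 0 <= F g) ->
  (\int[uniform_signs]_n (F (sign_code n))%:E = (N%:R^-1 * \sum_g F g)%:E)%E.
Proof.
move=> F0.
have F0E n : setT n -> (0 <= (F (sign_code n))%:E)%E by rewrite lee_fin.
have mF : measurable_fun setT (fun n => (F (sign_code n))%:E) by [].
rewrite ge0_integral_mscale//= ge0_integral_measure_sum// EFinM; congr (_ * _)%E.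
rewrite -sumEFin (eq_bigr (fun n : 'I_N => (F (sign_code n))%:E)); last first.
  by move=> n _; rewrite integral_dirac// diracT mul1e.
rewrite !sumEFin; congr EFin; rewrite -[in RHS]big_enum/=.
by rewrite (big_nth [ffun=> false]) big_mkord -cardE.
Qed.

Lemma integral_signs_prod (e : I -> bool -> R) : (forall i b, 0 <= e i b) ->
  (\int[uniform_signs]_n (\prod_i e i (sign_code n i))%:E =
   (\prod_i ((e i true + e i false) / 2))%:E)%E.
Proof.
move=> e0; rewrite (integral_signs (F := fun g => \prod_i e i (g i))); last first.
  by move=> g; rewrite prodr_ge0.
congr EFin; rewrite -(bigA_distr_bigA e) big_split/= mulrC; congr (_ * _).
  by apply: eq_bigr => i _; rewrite big_bool.
by rewrite prodr_const /N card_ffun card_bool natrX exprVn.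
Qed.

Let uniform_signsT : uniform_signs setT = 1%E.
Proof.
rewrite -[LHS]mul1e -integral_cst//.
transitivity (\int[uniform_signs]_n (\prod_(i : I) (fun=> fun=> 1) i (sign_code n i))%:E)%E.
  by apply: eq_integral => n _; rewrite big1.
by rewrite (integral_signs_prod (e := fun=> fun=> 1))// big1// => i _; field.
Qed.

HB.instance Definition _ :=
  @Measure_isProbability.Build _ _ R uniform_signs uniform_signsT.

(** The indicator of the intersection is a product over all indices, with factor 1 outside [J], so
    its mean factorises; comparing [J] with its singletons then gives independence. *)
Lemma random_sign_event (J : {set I}) (E : I -> set R) :
  (uniform_signs (\bigcap_(i in [set` J]) (random_sign i @^-1` E i)) =
   (\prod_(i in J) ((\1_(E i) (1 : R) + \1_(E i) (- 1 : R)) / 2))%:E)%E.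
Proof.
rewrite -[X in uniform_signs X]setIT -integral_indic//.
pose e i (b : bool) : R := if i \in J then \1_(E i) (if b then 1 else - 1 : R) else 1.
transitivity (\int[uniform_signs]_n (\prod_i e i (sign_code n i))%:E)%E.
  apply: eq_integral => n _; congr EFin; rewrite indicE.
  have [/set_mem h|/negP h] := boolP (n \in _).
    rewrite big1// => i _; rewrite /e; case: ifPn => // iJ.
    by rewrite indicE mem_set//; exact: h.
  apply/esym/eqP; rewrite prodf_seq_eq0; apply/hasP.
  have /existsNP[i /not_implyP[iJ Ei]] : ~ (forall i, i \in J -> (random_sign i @^-1` E i) n).
    by move=> k; apply: h; apply/mem_set => i; exact: k.
  exists i; first exact: mem_index_enum.
  by rewrite /e iJ indicE memNset//= eqxx.
rewrite integral_signs_prod => [|i b]; last by rewrite /e; case: ifP.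
congr EFin; rewrite [RHS]big_mkcond/=; apply: eq_bigr => i _.
by rewrite /e; case: ifP => // _; field.
Qed.

Lemma random_sign_independent : mutually_independent uniform_signs random_sign.
Proof.
move=> J E _; apply: (etrans (random_sign_event J E)).
rewrite -prodEFin; apply: eq_bigr => i iJ.
have := random_sign_event [set i]%SET E; rewrite big_set1 => h.
apply: (etrans (esym h)); apply: (congr1 uniform_signs).
by rewrite eqEsubset; split=> [n hn|n hn k /=]; [apply: hn; rewrite /= finset.in_set1|
  rewrite finset.in_set1 => /eqP->].
Qed.

Lemma random_sign_sqr i n : random_sign i n ^+ 2 = 1.
Proof. by rewrite /random_sign; case: ifP; rewrite ?sqrrN expr1n. Qed.

Lemma random_sign_subgaussian i : mgf_le_gaussian uniform_signs (random_sign i).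
Proof.
move=> l; pose e k (b : bool) : R := if k == i then expR (l * (if b then 1 else - 1)) else 1.
rewrite (eq_integral (fun n => (\prod_k e k (sign_code n k))%:E)); last first.
  move=> n _; rewrite (bigD1 i)//= big1 ?mulr1 => [|k /negbTE ki]; last by rewrite /e ki.
  by rewrite /e eqxx.
rewrite integral_signs_prod => [|k b]; last by rewrite /e; case: ifP => // _; exact: expR_ge0.
rewrite (bigD1 i)//= big1 ?mulr1 => [|k /negbTE ki]; last by rewrite /e ki; field.
by rewrite /e eqxx lee_fin mulr1 mulrN1 cosh_le_expR.
Qed.

End random_signs.

(** * Matrix norms *)

Section matrix_norms_theory.
Context (R : realType).

Lemma frobenius_norm_ge0 m n (A : 'M[R]_(m, n)) : 0 <= frobenius_norm A.
Proof. exact: sqrtr_ge0. Qed.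

Lemma frobenius_norm_sqr m n (A : 'M[R]_(m, n)) :
  frobenius_norm A ^+ 2 = \sum_i \sum_j A i j ^+ 2.
Proof.
by rewrite sqr_sqrtr// sumr_ge0// => i _; rewrite sumr_ge0// => j _; exact: sqr_ge0.
Qed.

Lemma frobenius_norm_col m (v : 'cV[R]_m) :
  frobenius_norm v ^+ 2 = \sum_i v i 0 ^+ 2.
Proof. by rewrite frobenius_norm_sqr; apply: eq_bigr => i _; rewrite big_ord1. Qed.

Lemma frobenius_norm_mulmx_le m n (A : 'M[R]_(m, n)) (v : 'cV[R]_n) :
  frobenius_norm (A *m v) <= frobenius_norm A * frobenius_norm v.
Proof.
rewrite -(@ler_pXn2r _ 2)// ?nnegrE ?mulr_ge0 ?frobenius_norm_ge0//.
rewrite exprMn !frobenius_norm_col frobenius_norm_sqr mulr_suml.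
apply: ler_sum => i _; rewrite mxE; exact: CauchySchwarz_sum.
Qed.

Lemma frobenius_normZ m n (c : R) (A : 'M[R]_(m, n)) :
  frobenius_norm (c *: A) = `|c| * frobenius_norm A.
Proof.
apply: (@pexpIrn _ 2); rewrite ?nnegrE ?mulr_ge0 ?frobenius_norm_ge0//.
rewrite exprMn !frobenius_norm_sqr real_normK ?num_real// mulr_sumr.
apply: eq_bigr => i _; rewrite mulr_sumr; apply: eq_bigr => j _.
by rewrite mxE exprMn.
Qed.

Lemma frobenius_norm0 m n : frobenius_norm (0 : 'M[R]_(m, n)) = 0.
Proof. by rewrite -(scale0r 0) frobenius_normZ normr0 mul0r. Qed.

Lemma operator_norm_has_sup m n (A : 'M[R]_(m, n)) :
  has_sup [set frobenius_norm (A *m v) | v in [set v : 'cV[R]_n | frobenius_norm v <= 1]].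
Proof.
split.
  exists (frobenius_norm (A *m (0 : 'cV_n))), 0 => //=.
  by rewrite frobenius_norm0.
exists (frobenius_norm A) => _ /= [v v1 <-].
by rewrite (le_trans (frobenius_norm_mulmx_le _ _))// ler_piMr ?frobenius_norm_ge0.
Qed.

Lemma operator_norm_ge0 m n (A : 'M[R]_(m, n)) : 0 <= operator_norm A.
Proof.
apply: (@le_trans _ _ (frobenius_norm (A *m (0 : 'cV_n)))); first exact: frobenius_norm_ge0.
apply: sup_upper_bound; first exact: operator_norm_has_sup.
by exists 0 => //=; rewrite frobenius_norm0.
Qed.

Lemma operator_norm_le m n (A : 'M[R]_(m, n)) (v : 'cV[R]_n) :
  frobenius_norm (A *m v) <= operator_norm A * frobenius_norm v.
Proof.
have [v0|v0] := eqVneq (frobenius_norm v) 0.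
  by rewrite v0 mulr0 (le_trans (frobenius_norm_mulmx_le _ _))// v0 mulr0.
have vp : 0 < frobenius_norm v by rewrite lt_neqAle eq_sym v0 frobenius_norm_ge0.
rewrite -ler_pdivrMr// mulrC.
have nE : `|(frobenius_norm v)^-1| = (frobenius_norm v)^-1.
  by rewrite ger0_norm// invr_ge0 ltW.
rewrite -nE -frobenius_normZ scalemxAr; apply: sup_upper_bound.
  exact: operator_norm_has_sup.
by exists ((frobenius_norm v)^-1 *: v) => //=; rewrite frobenius_normZ nE mulVf.
Qed.

Lemma operator_norm_sqr_le m n (A : 'M[R]_(m, n)) (v : 'I_n -> R) :
  \sum_i (\sum_j A i j * v j) ^+ 2 <= operator_norm A ^+ 2 * \sum_j v j ^+ 2.
Proof.
have := operator_norm_le A (\col_j v j).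
rewrite -(@ler_pXn2r _ 2)// ?nnegrE ?mulr_ge0 ?frobenius_norm_ge0 ?operator_norm_ge0//.
rewrite exprMn !frobenius_norm_col.
under eq_bigr do rewrite mxE; under [X in _ <= _ * X]eq_bigr do rewrite mxE.
by under eq_bigr do under eq_bigr do rewrite mxE.
Qed.

Lemma sum_inj_le (I J : finType) (h : I -> J) (F : J -> R) : injective h ->
  (forall j, 0 <= F j) -> \sum_i F (h i) <= \sum_j F j.
Proof.
move=> h_inj F0; rewrite [leRHS](bigID (mem (h @: I)))/=.
rewrite big_imset/=; last by move=> i k _ _; exact: h_inj.
by rewrite lerDl sumr_ge0.
Qed.

End matrix_norms_theory.

(** * Channel coordinates *)

Section blocks.
Context {K M : nat}.

Definition block (c : 'I_M * bool) : 'I_(2 * M) :=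
  if c.2 then im_block c.1 else re_block c.1.

Lemma block_inj : injective block.
Proof.
move=> [m s] [m' s'] /(congr1 val)/=; rewrite /block.
case: s; case: s' => /= /eqP; rewrite ?addn1 ?eqSS ?mul2n.
- by move=> /eqP/double_inj/val_inj->.
- by move=> /eqP/(congr1 odd); rewrite /= !odd_double.
- by move=> /eqP/(congr1 odd); rewrite /= !odd_double.
- by move=> /eqP/double_inj/val_inj->.
Qed.

(** In [b * K + k] the user is the remainder and the block the quotient modulo [K]. *)
Lemma fading_row_inj :
  injective (fun q : ('I_M * bool) * 'I_K => fading_row (block q.1) q.2).
Proof.
move=> [c k] [c' k'] /(congr1 val)/= E.
have K0 : (0 < K)%N by rewrite (leq_ltn_trans _ (ltn_ord k)).
have kk : k = k' by apply: val_inj; have := congr1 (modn^~ K) E;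
  rewrite /= !modnMDl !modn_small.
rewrite kk in E *; congr (_, _); apply: block_inj; apply: val_inj.
by move/eqP: E; rewrite eqn_add2r eqn_pmul2r// => /eqP.
Qed.

Lemma sum_fading_rows_le (R : realType) (F : 'I_(2 * K * M) -> R) :
  (forall i, 0 <= F i) ->
  \sum_(c : 'I_M * bool) \sum_(k : 'I_K) F (fading_row (block c) k) <= \sum_i F i.
Proof.
move=> F0; rewrite pair_bigA/=.
exact: (sum_inj_le (h := fun q => fading_row (block q.1) q.2) fading_row_inj F0).
Qed.

Lemma sum_blocks_le (R : realType) (F : 'I_(2 * M) -> R) : (forall i, 0 <= F i) ->
  \sum_(c : 'I_M * bool) F (block c) <= \sum_i F i.
Proof. exact: sum_inj_le block_inj. Qed.

End blocks.

(** * Reduction to centred coordinates *)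

Section centering.
Context d (Omega : measurableType d) (R : realType) (P : probability Omega R).

Definition centered (X : Omega -> R) (w : Omega) : R := X w - fine 'E_P[X]%E.

Lemma expectationE (X : Omega -> R) : ('E_P[X] = \int[P]_w (X w)%:E)%E.
Proof. by rewrite unlock. Qed.

(** The infimum in the sub-Gaussian norm need not be attained: norm at most 1 yields the moment
    bound with [1 + e] for every [e > 0], and [e] has to tend to 0. *)
Lemma expR_square_lim (l y : R) :
  (forall e, 0 < e -> y <= expR (l ^+ 2 * (1 + e) ^+ 2 / 2)) -> y <= expR (l ^+ 2 / 2).
Proof.
move=> bnd; have [y0|y0] := leP y 0; first by rewrite (le_trans y0)// expR_ge0.
rewrite -(lnK y0) ler_expR; apply/ler_addgt0Pr => e e0.
have c0 : 0 < 2 * l ^+ 2 + 1 by have := sqr_ge0 l; lra.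
pose r := Num.min 1 (e / (2 * l ^+ 2 + 1)).
have r0 : 0 < r by rewrite lt_min ltr01 divr_gt0.
have r1 : r <= 1 by rewrite ge_min lexx.
have re : r * (2 * l ^+ 2 + 1) <= e by rewrite -ler_pdivlMr// ge_min lexx orbT.
have := bnd r r0; rewrite -{1}(lnK y0) ler_expR => /le_trans; apply.
have l2r : 0 <= l ^+ 2 * (r * (1 - r)).
  by rewrite mulr_ge0 ?sqr_ge0// mulr_ge0 ?subr_ge0// ltW.
by lra.
Qed.

Lemma subgaussian_norm_le1 (X : Omega -> R) : (subgaussian_norm P X <= 1)%E ->
  mgf_le_gaussian P (centered X).
Proof.
move=> tau1 l.
have bnd e : 0 < e ->
    (\int[P]_w (expR (l * centered X w))%:E <= (expR (l ^+ 2 * (1 + e) ^+ 2 / 2))%:E)%E.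
  move=> e0.
  have : (subgaussian_norm P X < (1 + e)%:E)%E.
    by rewrite (le_lt_trans tau1)// lte_fin ltrDl.
  move=> /ereal_inf_lt[_ [t [t0 Xt] <-]]; rewrite lte_fin => te.
  move: (Xt l); rewrite [leLHS]expectationE => /le_trans; apply.
  rewrite lee_fin ler_expR ler_wpM2r// ler_wpM2l ?sqr_ge0//.
  by rewrite ler_pXn2r ?nnegrE ?ltW// (lt_trans t0).
have : (0 <= \int[P]_w (expR (l * centered X w))%:E)%E.
  by apply: integral_ge0 => w _; rewrite lee_fin expR_ge0.
case: (\int[P]_w (expR (l * centered X w))%:E)%E bnd => [y| |] bnd //.
- by move=> _; rewrite lee_fin; apply: expR_square_lim => e /bnd; rewrite lee_fin.
- by have := bnd 1 ltr01; rewrite leye_eq.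
Qed.

(** [fine] returns a real number even for an expectation that is not finite, so [X] always differs
    from its centred version by a constant, and the latter is integrable by its moment bound. *)
Lemma integrable_of_centered (X : Omega -> R) : measurable_fun setT X ->
  mgf_le_gaussian P (centered X) -> P.-integrable setT (EFin \o X).
Proof.
move=> mX subX.
have mC : measurable_fun setT (centered X) by exact: measurable_funB.
have -> : EFin \o X = (EFin \o centered X \+ cst (fine 'E_P[X])%:E)%E.
  by apply/funext => w; rewrite /= -EFinD subrK.
apply: integrableD => //; first exact: integrable_subgaussian.
exact: finite_measure_integrable_cst.
Qed.

Lemma integral_centered (X : Omega -> R) : P.-integrable setT (EFin \o X) ->
  (\int[P]_w (centered X w)%:E = 0)%E.
Proof.
move=> iX; have EX := expectationE X.
have fEX : 'E_P[X]%E \is a fin_num by rewrite EX; exact: integrable_fin_num.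
under eq_integral do rewrite /centered EFinB.
rewrite integralB//; last exact: finite_measure_integrable_cst.
rewrite integral_cst// [X in (_ - _ * X)%E]probability_setT mule1 fineK//.
by rewrite -EX subee.
Qed.

Lemma mutually_independent_centered (I : finType) (X : I -> Omega -> R) :
  mutually_independent P X -> mutually_independent P (fun i => centered (X i)).
Proof.
move=> indepX J E mE.
pose E' i : set R := (fun x => x - fine 'E_P[X i]%E) @^-1` E i.
have := indepX J E'; apply => i iJ.
rewrite -[E' i]setTI; apply: (measurable_funB (f := id) (g := cst _)) => //.
exact: mE.
Qed.

Lemma integral_linear_comb n (X : 'I_n -> Omega -> R) (c : 'I_n -> R) :
  (forall j, P.-integrable setT (EFin \o X j)) ->
  (\int[P]_w (\sum_j c j * X j w)%:E = (\sum_j c j * fine 'E_P[X j])%:E)%E.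
Proof.
move=> iX.
under eq_integral do rewrite -sumEFin.
rewrite integral_sum//; last by move=> j; exact: (integrableZl measurableT (c j) (iX j)).
rewrite -sumEFin; apply: eq_bigr => j _.
under eq_integral do rewrite EFinM.
have Efin : 'E_P[X j]%E \is a fin_num.
  by rewrite expectationE; exact: (integrable_fin_num measurableT (iX j)).
by rewrite (integralZl measurableT (iX j)) EFinM fineK// expectationE.
Qed.

(** The entries of R need not be centred, but fading and noise are: in each of their coordinates the
    means cancel, so R may be replaced by its centred version. *)
Lemma linear_comb_centered n (X : 'I_n -> Omega -> R) (c : 'I_n -> R) :
  (forall j, P.-integrable setT (EFin \o X j)) ->
  (\int[P]_w (\sum_j c j * X j w)%:E = 0)%E ->
  forall w, \sum_j c j * X j w = \sum_j c j * centered (X j) w.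
Proof.
move=> iX; rewrite integral_linear_comb// => /eqP; rewrite eqe => /eqP E0 w.
by under [RHS]eq_bigr do rewrite /centered mulrBr; rewrite sumrB E0 subr0.
Qed.

End centering.

Section fading.
Context d (Omega : measurableType d) (R : realType) (P : probability Omega R).
Context (I : finType) (X : I -> Omega -> R).
Hypothesis mX : forall i, measurable_fun setT (X i).
Hypothesis indepX : mutually_independent P X.
Hypothesis subX : forall i, mgf_le_gaussian P (X i).
Hypothesis meanX : forall i, (\int[P]_w (X i w)%:E = 0)%E.

Lemma variance_sum (H : Omega -> R) (c : I -> R) :
  (forall w, H w = \sum_i c i * X i w) -> 'E_P[H]%E = 0%E ->
  'V_P[H]%E = (\sum_i second_moment P (X i) * c i ^+ 2)%:E.
Proof.
move=> HE EH; rewrite /variance covariance.unlock EH expectationE.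
rewrite (eq_integral (fun w => ((\sum_i c i * X i w) ^+ 2)%:E)); last first.
  move=> w _; change (((H w - 0) * (H w - 0))%:E = ((\sum_i c i * X i w) ^+ 2)%:E).
  by rewrite subr0 HE expr2.
rewrite (integral_sum_sqr mX indepX subX meanX _ (index_enum_uniq _)).
by congr EFin; apply: eq_bigr => i _; rewrite mulrC.
Qed.

End fading.

(** * The transmission scheme *)

Section scheme.
Context (R : realType) (K M : nat) (power : R).
Context (dX : 'I_K -> measure_display) (X : forall k, measurableType (dX k)).
Context (fk : forall k : 'I_K, X k -> R).
Hypothesis power_gt0 : 0 < power.
Hypothesis fk_meas : forall k, measurable_fun [set: X k] (@fk k).
Hypothesis fk_bounded : forall k, bounded_set (range (@fk k)).

Definition height k (x : X k) : R := fk x - inf (range (@fk k)).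

Lemma fk_bounds k : has_lbound (range (@fk k)) /\ has_ubound (range (@fk k)).
Proof.
have [C [_ fkC]] := fk_bounded k.
have bnd (x : X k) : `|fk x| <= C + 1.
  by apply: (fkC (C + 1)); [rewrite ltrDl|exists x].
split; [exists (- (C + 1))|exists (C + 1)] => _ [x _ <-];
  by have := bnd x; rewrite ler_norml => /andP[].
Qed.

Lemma height_ge0 k (x : X k) : 0 <= height x.
Proof. by rewrite subr_ge0; apply: ge_inf; [exact: (fk_bounds k).1|exists x]. Qed.

Lemma height_le_spread k (x : X k) : height x <= spread fk k.
Proof. by rewrite lerB//; apply: ub_le_sup; [exact: (fk_bounds k).2|exists x]. Qed.

Lemma spread_ge0 k : 0 <= spread fk k.
Proof. exact: le_trans (height_ge0 point) (height_le_spread point). Qed.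

Lemma spread_le_max k : spread fk k <= max_spread fk.
Proof. by rewrite /max_spread (bigD1 k)//= le_max lexx. Qed.

Lemma max_spread_ge0 : 0 <= max_spread fk.
Proof.
rewrite /max_spread; elim/big_rec: _ => // k x _ x0.
by rewrite le_max x0 orbT.
Qed.

Lemma total_spread_ge0 : 0 <= total_spread fk.
Proof. by apply: sumr_ge0 => k _; exact: spread_ge0. Qed.

Lemma height_le_max k (x : X k) : height x <= max_spread fk.
Proof. exact: le_trans (height_le_spread x) (spread_le_max k). Qed.

(* When all spreads vanish this is 0 thanks to the convention x / 0 = 0. *)
Definition amplitude k (x : X k) : R := Num.sqrt (power * (height x / max_spread fk)).

Lemma amplitude_sqr_le k (x : X k) : amplitude x ^+ 2 <= power.
Proof.
rewrite sqr_sqrtr; last first.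
  by rewrite mulr_ge0 ?(ltW power_gt0)// divr_ge0 ?height_ge0 ?max_spread_ge0.
have [->|D0] := eqVneq (max_spread fk) 0; first by rewrite invr0 !mulr0 ltW.
rewrite ger_pMr// ler_pdivrMr ?mul1r ?height_le_max//.
by rewrite lt_neqAle eq_sym D0 max_spread_ge0.
Qed.

Lemma measurable_height k : measurable_fun setT (@height k).
Proof. exact: measurable_funB. Qed.

Lemma measurable_sqrtr : measurable_fun setT (@Num.sqrt R).
Proof. by apply: continuous_measurable_fun; exact: sqrt_continuous. Qed.

Lemma measurable_amplitude k : measurable_fun setT (@amplitude k).
Proof.
apply: (measurableT_comp measurable_sqrtr); apply: measurable_funM => //.
by apply: measurable_funM => //; exact: measurable_height.
Qed.

Lemma measurable_complexP d (T : measurableType d) (f : T -> R[i]) :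
  measurable_fun setT f <->
  measurable_fun setT (fun x => complex.Re (f x)) /\
  measurable_fun setT (fun x => complex.Im (f x)).
Proof.
have mpair : measurable_fun setT (@complex_pair R).
  by move=> _ B mB; exists B.
split=> [mf|[mre mim] _ A [B mB <-]].
  by split; [have := measurable_fst|have := measurable_snd] => /(_ _ _ R R) mp;
    exact: (measurableT_comp mp (measurableT_comp mpair mf)).
rewrite !setTI.
have mp : measurable_fun setT (fun x => (complex.Re (f x), complex.Im (f x))).
  exact/measurable_fun_pairP.
by have := mp measurableT B mB; rewrite setTI.
Qed.

Let PU : probability nat R := @uniform_signs R ('I_M * 'I_K)%type.

Definition sign_rv (k : 'I_K) (m : 'I_M) : {RV PU >-> R} :=
  HB.pack (random_sign R (m, k))
    (@isMeasurableFun.Build _ _ nat R (random_sign R (m, k)) (fun _ _ _ => Logic.I)).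

Definition encode k (m : 'I_M) (x : X k) (t : R) : R[i] := (amplitude x * t)%:C.

Lemma encode_measurable k : measurable_fun [set: X k * M.-tuple R]
  (fun p => [tuple encode m p.1 (tnth p.2 m) | m < M]).
Proof.
apply/measurable_fun_tnthP => m.
rewrite (_ : _ \o _ = fun p : X k * M.-tuple R => encode m p.1 (tnth p.2 m)); last first.
  by apply/funext => p /=; rewrite tnth_mktuple.
apply/measurable_complexP; split => //=; apply: measurable_funM.
  by apply: (measurableT_comp (@measurable_amplitude k)); exact: measurable_fst.
exact: (measurableT_comp (measurable_tnth m) measurable_snd).
Qed.

Lemma encode_power k (m : 'I_M) (x : X k) u :
  `|encode m x (sign_rv k m u)| ^+ 2 <= power%:C.
Proof.
rewrite /encode normc_def/= expr0n addr0 sqrtr_sqr -rmorphXn/= lecR.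
by rewrite real_normK ?num_real// exprMn random_sign_sqr mulr1 amplitude_sqr_le.
Qed.

(* [c] is to be the mean energy of the noise. *)
Definition decode (c : R) (y : M.-tuple R[i]) : R :=
  max_spread fk / (2 * M%:R * power) *
    (\sum_m (complex.Re (tnth y m) ^+ 2 + complex.Im (tnth y m) ^+ 2)) - c +
  \sum_(k < K) inf (range (@fk k)).

Lemma decode_measurable c : measurable_fun setT (decode c).
Proof.
apply: measurable_funD => //; apply: measurable_funB => //; apply: measurable_funM => //.
apply: measurable_sum => m.
have /measurable_complexP[mre mim] := @measurable_tnth _ R[i] _ m.
by apply: measurable_funD; exact: measurable_funX.
Qed.

Definition quadratic_scheme (c : R) : dfa_scheme M power X :=
  @DfaScheme R K M power dX X _ nat PU
    sign_rv encode (decode c) encode_measurable encode_power (decode_measurable c).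

End scheme.

Section estimate.
Context (R : realType) (K M : nat) (power : R).
Context (dX : 'I_K -> measure_display) (X : forall k, measurableType (dX k)).
Context (fk : forall k : 'I_K, X k -> R).
Hypothesis power_gt0 : 0 < power.
Hypothesis M_gt0 : (0 < M)%N.
Hypothesis fk_meas : forall k, measurable_fun [set: X k] (@fk k).
Hypothesis fk_bounded : forall k, bounded_set (range (@fk k)).

Let D := max_spread fk.
Let M0 : 0 < M%:R :> R. Proof. by rewrite ltr0n. Qed.
Let D0 : 0 <= D. Proof. exact: max_spread_ge0. Qed.

(** The gain that brings the received energy to the scale of [f]. User [k] then arrives with
    amplitude [signal_gain], whose square is the height shared among the [2 M] real coordinates. *)
Definition noise_gain : R := Num.sqrt (D / (2 * M%:R * power)).
Definition signal_gain k (x : X k) : R := Num.sqrt (height fk x / (2 * M%:R)).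

Lemma noise_gain_sqr : noise_gain ^+ 2 = D / (2 * M%:R * power).
Proof. by rewrite sqr_sqrtr// divr_ge0// !mulr_ge0// ltW. Qed.

Lemma signal_gain_sqr k (x : X k) : signal_gain x ^+ 2 = height fk x / (2 * M%:R).
Proof.
by rewrite sqr_sqrtr// divr_ge0// ?mulr_ge0 ?(ltW M0)//; exact: height_ge0.
Qed.

Lemma noise_gain_amplitude k (x : X k) :
  noise_gain * amplitude power fk x = signal_gain x.
Proof.
have h0 := height_ge0 fk_bounded x.
rewrite /noise_gain /amplitude -sqrtrM; last by rewrite divr_ge0// !mulr_ge0// ltW.
rewrite /signal_gain; congr Num.sqrt; rewrite -/D.
(* If the maximal spread is 0, all heights vanish, in accordance with the convention for division by
   0. *)
have [D00|Dn0] := eqVneq D 0.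
  have -> : height fk x = 0.
    by apply/eqP; rewrite eq_le h0 andbT -[leRHS]D00; exact: height_le_max.
  by rewrite !mul0r !mulr0.
by field; rewrite Dn0 (gt_eqF power_gt0) (gt_eqF M0).
Qed.

Lemma ReD_sum (I : finType) (F : I -> R[i]) (z : R[i]) :
  complex.Re (\sum_i F i + z) = \sum_i complex.Re (F i) + complex.Re z.
Proof.
have ReD (x y : R[i]) : complex.Re (x + y) = complex.Re x + complex.Re y.
  by case: x y => [? ?] [].
by rewrite ReD; congr (_ + _); apply: (big_morph _ ReD).
Qed.

Lemma ImD_sum (I : finType) (F : I -> R[i]) (z : R[i]) :
  complex.Im (\sum_i F i + z) = \sum_i complex.Im (F i) + complex.Im z.
Proof.
have ImD (x y : R[i]) : complex.Im (x + y) = complex.Im x + complex.Im y.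
  by case: x y => [? ?] [].
by rewrite ImD; congr (_ + _); apply: (big_morph _ ImD).
Qed.

Lemma Re_mul_real (z : R[i]) (t : R) : complex.Re (z * t%:C) = complex.Re z * t.
Proof. by case: z => a b /=; rewrite mulr0 subr0. Qed.

Lemma Im_mul_real (z : R[i]) (t : R) : complex.Im (z * t%:C) = complex.Im z * t.
Proof. by case: z => a b /=; rewrite mulr0 add0r. Qed.

(** A pointwise identity: real symbols act alike on the real and imaginary parts of the fading, and
    the infima added by the decoder turn the sum of the heights into [f]. *)
Lemma quadratic_estimate (J : finType) (A : 'I_M * bool -> 'I_K -> J -> R)
    (B : 'I_M * bool -> J -> R) (sg r : J -> R)
    (h : 'I_K -> 'I_M -> R[i]) (n : 'I_M -> R[i]) (x : forall k, X k) (u : nat) :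
  (forall k m, complex.Re (h k m) = \sum_j A (m, false) k j * r j) ->
  (forall k m, complex.Im (h k m) = \sum_j A (m, true) k j * r j) ->
  (forall m, complex.Re (n m) = \sum_j B (m, false) j * r j) ->
  (forall m, complex.Im (n m) = \sum_j B (m, true) j * r j) ->
  dfa_estimate (quadratic_scheme M power_gt0 fk_meas fk_bounded
      (noise_gain ^+ 2 * (\sum_c \sum_j sg j * B c j ^+ 2))) h n x u -
    \sum_k fk (x k) =
  estimation_error A B (fun k => signal_gain (x k)) noise_gain sg
    (fun i => random_sign R i u) r.
Proof.
move=> hRe hIm nRe nIm.
set al := fun k => signal_gain (x k); set U := fun i => random_sign R i u.
rewrite /dfa_estimate /= /decode -/D -noise_gain_sqr /estimation_error.
rewrite (_ : (2 * #|'I_M|)%:R * \sum_k al k ^+ 2 = \sum_k height fk (x k)); last first.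
  rewrite card_ord mulr_sumr; apply: eq_bigr => k _.
  by rewrite signal_gain_sqr natrM; field; rewrite gt_eqF.
have -> : \sum_k height fk (x k) = \sum_k fk (x k) - \sum_k inf (range (@fk k)).
  by rewrite -sumrB.
set T := \sum_m (complex.Re _ ^+ 2 + complex.Im _ ^+ 2).
suff -> : noise_gain ^+ 2 * T = \sum_c (\sum_j received A B al noise_gain U c j * r j) ^+ 2.
  by ring.
rewrite {}/T.
have recvE c : \sum_j received A B al noise_gain U c j * r j =
    noise_gain * (\sum_k (\sum_j A c k j * r j) * (amplitude power fk (x k) * U (c.1, k)) +
      \sum_j B c j * r j).
  rewrite mulrDr !mulr_sumr.
  rewrite (eq_bigr (fun k => \sum_j al k * U (c.1, k) * A c k j * r j)); last first.
    move=> k _; rewrite /al -noise_gain_amplitude mulr_suml mulr_sumr.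
    by apply: eq_bigr => j _; ring.
  rewrite exchange_big/= -big_split/=; apply: eq_bigr => j _.
  by rewrite /received mulrDl mulr_suml mulrA.
rewrite sum_prodE/= mulr_sumr; apply: eq_bigr => m _.
rewrite big_bool/= !recvE !exprMn -mulrDr addrC tnth_mktuple; congr (_ * _).
rewrite ReD_sum ImD_sum nRe nIm /encode; congr (_ ^+ 2 + _ ^+ 2); congr (_ + _);
  by apply: eq_bigr => k _; rewrite ?Re_mul_real ?Im_mul_real ?hRe ?hIm.
Qed.

End estimate.

(** * Markov's inequality and integration over the product space *)

(** The indicator of [|Z| >= e] is at most [expR (- (t * e))] times [expR (t * Z) + expR (- t * Z)];
    the two tails produce the factor 2. *)
Lemma exp_markov d (T : measurableType d) (R : realType)
    (mu : {measure set T -> \bar R}) (Z : T -> R) (t e c : R) : 0 < t ->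
  measurable_fun setT Z ->
  (\int[mu]_w (expR (t * Z w))%:E <= c%:E)%E ->
  (\int[mu]_w (expR (- t * Z w))%:E <= c%:E)%E ->
  (mu [set w | (e <= `|Z w|)%R] <= (2 * c * expR (- (t * e)))%:E)%E.
Proof.
move=> t0 mZ Zp Zn.
have mexp s : measurable_fun setT (fun w => (expR (s * Z w))%:E).
  by apply/measurable_EFinP; apply: measurableT_comp => //; exact: measurable_funM.
have mE : measurable [set w | e <= `|Z w|].
  rewrite (_ : [set w | _] = (fun w => `|Z w|) @^-1` `[e, +oo[); last first.
    by apply/seteqP; split=> w /=; rewrite in_itv/= andbT.
  by rewrite -[_ @^-1` _]setTI; apply: (measurableT_comp (@normr_measurable R setT)).
rewrite -[X in mu X]setIT -integral_indic//.
pose g w := ((expR (- (t * e)))%:E * ((expR (t * Z w))%:E + (expR (- t * Z w))%:E))%E.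
apply: (@le_trans _ _ (\int[mu]_w g w)%E).
  apply: ge0_le_integral => //.
  - by apply/measurable_EFinP; exact: measurable_indic.
  - by apply: measurable_funeM; exact: emeasurable_funD.
  - move=> w _; rewrite /g -EFinD -EFinM lee_fin indicE.
    have [/set_mem|_] := boolP (w \in _); last first.
      by rewrite mulr_ge0 ?addr_ge0 ?expR_ge0.
    rewrite /= mulrDr -!expRD lter_normr => /orP[] eZ.
      apply: (@le_trans _ _ (expR (- (t * e) + t * Z w))).
        by rewrite -[leLHS]expR0 ler_expR addrC subr_ge0 ler_wpM2l// ltW.
      by rewrite lerDl expR_ge0.
    apply: (@le_trans _ _ (expR (- (t * e) + - t * Z w))).
      by rewrite -[leLHS]expR0 ler_expR mulNr -mulrN addrC subr_ge0 ler_wpM2l// ltW.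
    by rewrite lerDr expR_ge0.
rewrite /g ge0_integralZl//; last 2 first.
- exact: emeasurable_funD.
- by move=> w _; rewrite -EFinD lee_fin addr_ge0 ?expR_ge0.
rewrite ge0_integralD//.
apply: (@le_trans _ _ ((expR (- (t * e)))%:E * (c%:E + c%:E))%E).
  by rewrite lee_wpmul2l ?lee_fin ?expR_ge0// leeD.
by rewrite -EFinD -EFinM lee_fin; lra.
Qed.

Section product_integral.
Context dU (OmegaU : measurableType dU) d (Omega : measurableType d).
Context dQ (OmegaQ : measurableType dQ) (R : realType).
Context (P : probability Omega R) (PU : probability OmegaU R) (Q : probability OmegaQ R).

Let product_probability_setT : (P \x PU)%E setT = 1%E.
Proof.
rewrite -setXTT product_measure1E// -[RHS]mule1.
by congr (_ * _)%E; exact: probability_setT.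
Qed.

Let PPU : probability (Omega * OmegaU)%type R := HB.pack (P \x PU)%E
  (@Measure_isProbability.Build _ _ R (P \x PU)%E product_probability_setT).

(** The data are integrated last, so a bound for fixed data suffices; this is why their distribution
    may be arbitrary. *)
Lemma integral_product3_le (g : Omega * OmegaU * OmegaQ -> \bar R) (c : R) :
  measurable_fun setT g -> (forall w, 0 <= g w)%E ->
  (forall q, \int[PU]_u \int[P]_w g (w, u, q) <= c%:E)%E ->
  (\int[(P \x PU) \x Q]_w g w <= c%:E)%E.
Proof.
move=> mg g0 gc; change (\int[(PPU \x Q)%E]_w g w <= c%:E)%E.
rewrite (@fubini_tonelli1 _ _ _ _ _ PPU Q)// /fubini_F.
rewrite (@fubini_tonelli _ _ _ _ _ PPU Q)//.
apply: (@le_trans _ _ (\int[Q]_q c%:E)%E); last first.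
  by rewrite integral_cst// [X in (_ * X)%E]probability_setT mule1.
apply: ge0_le_integral => //.
- by move=> q _; apply: integral_ge0.
- exact: (@measurable_fun_fubini_tonelli_G _ _ _ _ _ _ g mg g0).
- move=> q _; have mh : measurable_fun setT (fun z => g (z, q)).
    exact: (@measurableT_comp _ _ _ _ _ _ g _ (pair^~ q) mg (pair2_measurable q)).
  rewrite (fubini_tonelli1 (fun z => g (z, q)))// /fubini_F.
  by rewrite (fubini_tonelli (fun z => g (z, q))).
Qed.

End product_integral.

(** * The tail of the estimation error *)

Section error_tail.
Context dU (OmegaU : measurableType dU) d (Omega : measurableType d).
Context dQ (OmegaQ : measurableType dQ) (R : realType).
Context (PU : probability OmegaU R) (P : probability Omega R) (Q : probability OmegaQ R).
Context (Mt Kt J : finType).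
Context (X : J -> Omega -> R) (U : Mt * Kt -> OmegaU -> R).
Hypothesis mX : forall j, measurable_fun setT (X j).
Hypothesis indepX : mutually_independent P X.
Hypothesis subX : forall j, mgf_le_gaussian P (X j).
Hypothesis mU : forall i, measurable_fun setT (U i).
Hypothesis indepU : mutually_independent PU U.
Hypothesis subU : forall i, mgf_le_gaussian PU (U i).
Hypothesis U2 : forall i w, U i w ^+ 2 = 1.
Context (A : Mt * bool -> Kt -> J -> R) (B : Mt * bool -> J -> R).
Context (al : OmegaQ -> Kt -> R) (be : R) (a b aF bF p : R).
Hypothesis mal : forall k, measurable_fun setT (al^~ k).
Hypotheses (a0 : 0 <= a) (b0 : 0 <= b) (aF0 : 0 <= aF) (bF0 : 0 <= bF).
Hypotheses (p0 : 0 <= p) (be0 : 0 <= be).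
Hypothesis al_le : forall q, \sum_k al q k ^+ 2 <= p ^+ 2.
Hypothesis A_op : forall v : J -> R,
  \sum_c \sum_k (\sum_j A c k j * v j) ^+ 2 <= a ^+ 2 * \sum_j v j ^+ 2.
Hypothesis B_op : forall v : J -> R,
  \sum_c (\sum_j B c j * v j) ^+ 2 <= b ^+ 2 * \sum_j v j ^+ 2.
Hypothesis A_fro : \sum_c \sum_k \sum_j A c k j ^+ 2 <= aF ^+ 2.
Hypothesis B_fro : \sum_c \sum_j B c j ^+ 2 <= bF ^+ 2.

Let sg j := second_moment P (X j).
Hypothesis A_var : forall c k, \sum_j sg j * A c k j ^+ 2 = 1.

Let W := (p * a + be * b) ^+ 2.
Let V := W * (p * aF + be * bF) ^+ 2.
Let Z (w : Omega * OmegaU * OmegaQ) : R :=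
  estimation_error A B (al w.2) be sg (U^~ w.1.2) (X^~ w.1.1).

Lemma measurable_error : measurable_fun setT Z.
Proof.
have mX2 j : measurable_fun setT (fun z : Omega * OmegaU * OmegaQ => X j z.1.1).
  exact: (measurableT_comp (@mX j) (measurableT_comp measurable_fst measurable_fst)).
have mU1 i : measurable_fun setT (fun z : Omega * OmegaU * OmegaQ => U i z.1.2).
  exact: (measurableT_comp (@mU i) (measurableT_comp measurable_snd measurable_fst)).
have mal2 k : measurable_fun setT (fun z : Omega * OmegaU * OmegaQ => al z.2 k).
  exact: (measurableT_comp (@mal k) measurable_snd).
apply: measurable_funB.
  apply: measurable_funB => //.
  apply: measurable_sum => c; apply: measurable_funX; apply: measurable_sum => j.
  apply: measurable_funM => //; apply: measurable_funD => //.
  by apply: measurable_sum => k; do 2 apply: measurable_funM => //.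
apply: measurable_funM => //; apply: measurable_sum => k; exact: measurable_funX.
Qed.

Lemma integral_error_le t : `|t| * W <= 1 / 32 ->
  (\int[(P \x PU) \x Q]_w (expR (t * Z w))%:E <= (expR (130 * (t ^+ 2 * V)))%:E)%E.
Proof.
move=> tW; apply: integral_product3_le.
- apply/measurable_EFinP; apply: measurableT_comp => //; apply: measurable_funM => //.
  exact: measurable_error.
- by move=> w; rewrite lee_fin expR_ge0.
move=> q.
exact: (error_mgf mX indepX subX mU indepU subU U2 a0 b0 aF0 bF0 p0 be0 (@al_le q)
  A_op B_op A_fro B_fro A_var tW).
Qed.

Lemma error_tail t e : 0 < t -> t * W <= 1 / 32 ->
  (((P \x PU) \x Q) [set w | (e <= `|Z w|)%R] <=
   (2 * expR (130 * (t ^+ 2 * V)) * expR (- (t * e)))%:E)%E.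
Proof.
move=> t0 tW; apply: exp_markov => //; first exact: measurable_error.
  by apply: integral_error_le; rewrite gtr0_norm.
by rewrite -(sqrrN t); apply: integral_error_le; rewrite normrN gtr0_norm.
Qed.

End error_tail.

(* The hypothesis is the second term of the maximum in the theorem, with
   [L = 2 * m * W] and [F = 4 * m * V]. *)
Lemma tail_exponent (R : realType) (m e s W V : R) : 0 < m -> 0 < e -> 0 < s ->
  0 <= W -> 0 <= V ->
  s / e ^+ 2 * (256 * (4 * m * V) + 32 * e * (2 * m * W)) <= m ->
  2 * s / e * W <= 1 / 32 /\ 130 * ((2 * s / e) ^+ 2 * V) - 2 * s / e * e <= - s.
Proof.
move=> m0 e0 s0 W0 V0.
rewrite (_ : _ * (_ + _) = m * (s * (1024 * V + 64 * e * W)) / e ^+ 2); last by ring.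
rewrite ler_pdivrMr ?exprn_gt0// ler_pM2l// => h.
have eW : 0 <= s * (e * W) by rewrite !mulr_ge0// ltW.
have sV : 0 <= s * V by rewrite mulr_ge0// ltW.
split.
  rewrite mulrAC ler_pdivrMr// -(ler_pM2l e0).
  by rewrite expr2 in h; lra.
rewrite divfK ?gt_eqF//.
have -> : (2 * s / e) ^+ 2 * V = 4 * (s * (s * V)) / e ^+ 2 by field; rewrite gt_eqF.
(* The quadratic term is then at most [130 / 256 * s], while the linear term is [- 2 s]. *)
suff : 4 * (s * (s * V)) / e ^+ 2 <= s / 256 by lra.
rewrite ler_pdivrMr ?exprn_gt0//.
have : s * (1024 * (s * V)) <= s * e ^+ 2 by rewrite ler_pM2l//; lra.
by lra.
Qed.

(** The 4 pays for the two tails and leaves another factor 2: the bound obtained is [delta / 2]. *)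
Lemma two_expR_le (R : realType) (delta x y : R) : 0 < delta ->
  x - y <= - (ln 4 - ln delta) -> 2 * expR x * expR (- y) <= delta.
Proof.
move=> d0 xy; rewrite -mulrA -expRD.
apply: (@le_trans _ _ (2 * expR (ln delta - ln 4))); first by rewrite ler_pM2l// ler_expR; lra.
rewrite expRD expRN !lnK ?posrE//; lra.
Qed.

Theorem corollary4 (R : realType) (K M : nat) (power : R)
    (hK : (0 < K)%N) (hM : (0 < M)%N) (hpower : 0 < power)
    (* alphabets and estimator *)
    (dX : 'I_K -> measure_display) (X : forall k : 'I_K, measurableType (dX k))
    (Y : set R)
    (f : (forall k : 'I_K, X k) -> R) (fk : forall k : 'I_K, X k -> R)
    (hf : forall x : (forall k : 'I_K, X k), f x = \sum_(k < K) fk k (x k))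
    (hfk_meas : forall k : 'I_K, measurable_fun [set: X k] (fk k))
    (hfk_bounded : forall k : 'I_K, bounded_set (range (fk k)))
    (* loss *)
    (loss : (forall k : 'I_K, X k) -> R -> R -> R) (Lam : R) (hLam : 0 < Lam)
    (hloss_ge0 : forall (x : forall k : 'I_K, X k) (y t : R),
       Y y -> 0 <= loss x y t)
    (hloss_lip : forall (x : forall k : 'I_K, X k) (y : R),
       Y y -> Lam.-lipschitz (loss x y))
    (* channel *)
    (dC : measure_display) (OmegaC : measurableType dC)
    (PC : probability OmegaC R)
    (H : 'I_K -> 'I_M -> {RV PC >-> R[i]}) (N : 'I_M -> {RV PC >-> R[i]})
    (hH : forall (k : 'I_K) (m : 'I_M),
       standardized_subgaussian PC (fun w => complex.Re (H k m w)) /\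
       standardized_subgaussian PC (fun w => complex.Im (H k m w)))
    (hN : forall m : 'I_M,
       centered_subgaussian PC (fun w => complex.Re (N m w)) /\
       centered_subgaussian PC (fun w => complex.Im (N m w)))
    (A Ai : 'M[R]_(2 * K * M, 2 * K * M + 2 * M))
    (B : 'M[R]_(2 * M, 2 * K * M + 2 * M))
    (hAB : correlated_as_determined_by H N A B)
    (hAi : user_uncorrelated Ai)
    (eta : R) (heta : operator_norm ((A + Ai) *m (A - Ai)^T) <= eta)
    (* accuracy and number of channel uses *)
    (eps delta : R) (heps : 0 < eps) (hdelta : 0 < delta < 1)
    (hM_large :
       let Dbar := total_spread fk in
       let Dmax := max_spread fk in
       let L := (Num.sqrt Dbar * operator_norm A +
                 Num.sqrt (Dmax / power) * operator_norm B) ^+ 2 in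
       let F := L *
                (Num.sqrt (Dbar / M%:R) * frobenius_norm A +
                 Num.sqrt (Dmax / (power * M%:R)) * frobenius_norm B) ^+ 2 in
       let D := (4 * Num.sqrt (2 * M%:R) * Dbar * eta +
                 4 * (Dmax / Num.sqrt (power * M%:R)) *
                   frobenius_norm (A *m B^T)) ^+ 2 in
       (ln 4 - ln delta) / eps ^+ 2 *
         Num.max (16 * F + D + 4 * eps * L) (256 * F + 32 * eps * L) <= M%:R) :
  exists S : dfa_scheme M power X,
    forall (dQ : measure_display) (OmegaQ : measurableType dQ)
      (Q : probability OmegaQ R) (x : forall k : 'I_K, {RV Q >-> X k}) (y : R),
      Y y ->
      (* outer probability: no measurability of the loss is assumed; it agrees
         with the probability on measurable events *)
      (mu_ext ((PC \x dfa_prob S) \x Q)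
         [set w : OmegaC * dfa_space S * OmegaQ |
            let xK := fun k : 'I_K => x k w.2 in
            let fbar := dfa_estimate S (fun k m => H k m w.1.1)
                          (fun m => N m w.1.1) xK w.1.2 in
            (Lam * eps <= `|loss xK y fbar - loss xK y (f xK)|)%R ]
       <= delta%:E)%E.
Proof.
have [Xr [indepXr normXr HE NE]] := hAB.
pose Xt j := centered PC (Xr j).
have mX j : measurable_fun setT (Xt j) by exact: measurable_funB.
have subX j : mgf_le_gaussian PC (Xt j) by exact: subgaussian_norm_le1.
have intX j : PC.-integrable setT (EFin \o Xr j) by exact: (integrable_of_centered _ (subX j)).
have meanX j : (\int[PC]_w (Xt j w)%:E = 0)%E by exact: (integral_centered (intX j)).
have indepX : mutually_independent PC Xt by exact: mutually_independent_centered.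
have linE (c : 'I_(2 * K * M + 2 * M) -> R) (Z : OmegaC -> R) :
    (forall w, Z w = \sum_j c j * Xr j w) -> 'E_PC[Z]%E = 0%E ->
    forall w, Z w = \sum_j c j * Xt j w.
  move=> ZE EZ w; rewrite ZE; apply: (linear_comb_centered intX).
  by rewrite -EZ expectationE; apply: eq_integral => z _; rewrite ZE.
pose A' c k j := A (fading_row (block c) k) j.
pose B' c j := B (block c) j.
have Hre k m w : complex.Re (H k m w) = \sum_j A' (m, false) k j * Xt j w.
  apply: (linE (A' (m, false) k) (fun w => complex.Re (H k m w))); last by have [[]] := hH k m.
  by move=> v; rewrite (HE v k m).1 mxE; apply: eq_bigr => j _; rewrite mxE.
have Him k m w : complex.Im (H k m w) = \sum_j A' (m, true) k j * Xt j w.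
  apply: (linE (A' (m, true) k) (fun w => complex.Im (H k m w))); last by have [_ []] := hH k m.
  by move=> v; rewrite (HE v k m).2 mxE; apply: eq_bigr => j _; rewrite mxE.
have Nre m w : complex.Re (N m w) = \sum_j B' (m, false) j * Xt j w.
  apply: (linE (B' (m, false)) (fun w => complex.Re (N m w))); last by have [[]] := hN m.
  by move=> v; rewrite (NE v m).1 mxE; apply: eq_bigr => j _; rewrite mxE.
have Nim m w : complex.Im (N m w) = \sum_j B' (m, true) j * Xt j w.
  apply: (linE (B' (m, true)) (fun w => complex.Im (N m w))); last by have [_ []] := hN m.
  by move=> v; rewrite (NE v m).2 mxE; apply: eq_bigr => j _; rewrite mxE.
pose sg j := second_moment PC (Xt j).
have A_var c k : \sum_j sg j * A' c k j ^+ 2 = 1.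
  have [[_ Ere Vre] [_ Eim Vim]] := hH k c.1.
  apply: EFin_inj; case: c Ere Vre Eim Vim => m [] /= Ere Vre Eim Vim.
    by rewrite -(variance_sum mX indepX subX meanX (Him k m)).
  by rewrite -(variance_sum mX indepX subX meanX (Hre k m)).
have A_op (v : _ -> R) : \sum_c \sum_k (\sum_j A' c k j * v j) ^+ 2 <=
    operator_norm A ^+ 2 * \sum_j v j ^+ 2.
  apply: le_trans (operator_norm_sqr_le A v).
  by apply: (sum_fading_rows_le (F := fun i => (\sum_j A i j * v j) ^+ 2)) => i; exact: sqr_ge0.
have B_op (v : _ -> R) : \sum_c (\sum_j B' c j * v j) ^+ 2 <=
    operator_norm B ^+ 2 * \sum_j v j ^+ 2.
  apply: le_trans (operator_norm_sqr_le B v).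
  by apply: (sum_blocks_le (F := fun i => (\sum_j B i j * v j) ^+ 2)) => i; exact: sqr_ge0.
have A_fro : \sum_c \sum_k \sum_j A' c k j ^+ 2 <= frobenius_norm A ^+ 2.
  rewrite frobenius_norm_sqr; apply: (sum_fading_rows_le (F := fun i => \sum_j A i j ^+ 2)).
  by move=> i; apply: sumr_ge0 => j _; exact: sqr_ge0.
have B_fro : \sum_c \sum_j B' c j ^+ 2 <= frobenius_norm B ^+ 2.
  rewrite frobenius_norm_sqr; apply: (sum_blocks_le (F := fun i => \sum_j B i j ^+ 2)).
  by move=> i; apply: sumr_ge0 => j _; exact: sqr_ge0.
have M0 : 0 < M%:R :> R by rewrite ltr0n.
have Dbar0 : 0 <= total_spread fk by exact: total_spread_ge0.
have Dmax0 : 0 <= max_spread fk by exact: max_spread_ge0.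
(* [p^2] bounds the sum of the squared signal gains for every value of the data. *)
pose p := Num.sqrt (total_spread fk / (2 * M%:R)).
pose be := noise_gain M power fk.
(* The constant given to the decoder is the mean energy of the scaled noise; it does not depend on
   the data, so the scheme is fixed before them. *)
exists (quadratic_scheme M hpower hfk_meas hfk_bounded
  (be ^+ 2 * (\sum_c \sum_j sg j * B' c j ^+ 2))).
move=> dQ OmegaQ Q x y Yy.
pose al q k := signal_gain M fk (x k q).
have al_le q : \sum_k al q k ^+ 2 <= p ^+ 2.
  rewrite sqr_sqrtr ?divr_ge0 ?mulr_ge0 ?(ltW M0)// mulr_suml.
  apply: ler_sum => k _; rewrite signal_gain_sqr// ler_pM2r ?invr_gt0 ?mulr_gt0//.
  exact: height_le_spread.
have mal k : measurable_fun setT (al^~ k).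
  have mh : measurable_fun setT (fun q => height fk (x k q) / (2 * M%:R)).
    apply: measurable_funM => //.
    exact: (measurableT_comp (measurable_height hfk_meas (k := k)) (measurable_funPT (x k))).
  exact: (measurableT_comp (@measurable_sqrtr R) mh).
pose U := @random_sign R ('I_M * 'I_K)%type.
pose Z (w : OmegaC * nat * OmegaQ) :=
  estimation_error A' B' (al w.2) be sg (U^~ w.1.2) (Xt^~ w.1.1).
have ZE w : dfa_estimate (quadratic_scheme M hpower hfk_meas hfk_bounded
    (be ^+ 2 * (\sum_c \sum_j sg j * B' c j ^+ 2)))
    (fun k m => H k m w.1.1) (fun m => N m w.1.1) (fun k => x k w.2) w.1.2 -
    f (fun k => x k w.2) = Z w.
  rewrite hf; apply: (quadratic_estimate hpower hM hfk_meas hfk_bounded (A := A') (B := B')).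
  - by move=> k m; exact: Hre.
  - by move=> k m; exact: Him.
  - by move=> m; exact: Nre.
  - by move=> m; exact: Nim.
have mU i : measurable_fun setT (U i) by [].
have mZ : measurable_fun setT Z by exact: measurable_error.
(* The Lipschitz bound puts the loss event inside an event for [Z], which is measurable, and there
   the outer measure is the product measure. *)
apply: (@le_trans _ _ (mu_ext ((PC \x uniform_signs R ('I_M * 'I_K)%type) \x Q)%E
    [set w | (eps <= `|Z w|)%R])).
  apply: le_mu_ext => w /= /le_trans h.
  rewrite -(ler_pM2l hLam) -ZE; apply: h.
  exact: (hloss_lip _ _ Yy (_, _)).
rewrite measurable_mu_extE; last first.
  rewrite (_ : [set w | _] = (fun w => `|Z w|) @^-1` `[eps, +oo[); last first.
    by apply/seteqP; split=> w /=; rewrite in_itv/= andbT.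
  by rewrite -[_ @^-1` _]setTI; apply: (measurableT_comp (@normr_measurable R setT)).
pose s := ln 4 - ln delta.
have /andP[d0 d1] := hdelta.
have s0 : 0 < s.
  by rewrite subr_gt0 ltr_ln ?posrE//; lra.
pose W := (p * operator_norm A + be * operator_norm B) ^+ 2.
pose V := W * (p * frobenius_norm A + be * frobenius_norm B) ^+ 2.
have M20 : 0 < 2 * M%:R :> R by rewrite mulr_gt0.
have sM2 : Num.sqrt (2 * M%:R) ^+ 2 = 2 * M%:R :> R by rewrite sqr_sqrtr// ltW.
have [tW tV] : 2 * s / eps * W <= 1 / 32 /\
    130 * ((2 * s / eps) ^+ 2 * V) - 2 * s / eps * eps <= - s.
  have W0 : 0 <= W by exact: sqr_ge0.
  have V0 : 0 <= V by rewrite mulr_ge0 ?sqr_ge0.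
  apply: (tail_exponent M0 heps s0 W0 V0).
  (* The square roots in [L] and [F] are expressed through [p] and [be]: [sqM] extracts the factor
     [2 M] of [L], and [sq2] the 2 in the second factor of [F]. *)
  have sqM (z : R) : 0 <= z -> Num.sqrt z = Num.sqrt (2 * M%:R) * Num.sqrt (z / (2 * M%:R)).
    move=> z0; rewrite -sqrtrM ?(ltW M20)//; congr Num.sqrt; field.
    by rewrite (gt_eqF M0).
  have sq2 (z : R) : 0 <= z -> Num.sqrt (z / M%:R) = Num.sqrt 2 * Num.sqrt (z / (2 * M%:R)).
    move=> z0; rewrite -sqrtrM//; congr Num.sqrt; field.
    by rewrite (gt_eqF M0).
  have s2 : Num.sqrt 2 ^+ 2 = 2 :> R by rewrite sqr_sqrtr.
  have beE : Num.sqrt (max_spread fk / power / (2 * M%:R)) = be.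
    by rewrite /be /noise_gain -mulrA -invfM [_ * (2 * _)]mulrC.
  have DP0 : 0 <= max_spread fk / power by rewrite divr_ge0// ltW.
  have LE : (Num.sqrt (total_spread fk) * operator_norm A +
      Num.sqrt (max_spread fk / power) * operator_norm B) ^+ 2 = 2 * M%:R * W.
    by rewrite (sqM _ Dbar0) (sqM _ DP0) beE -/p -[in RHS]sM2 /W; ring.
  have FE : (Num.sqrt (total_spread fk / M%:R) * frobenius_norm A +
      Num.sqrt (max_spread fk / (power * M%:R)) * frobenius_norm B) ^+ 2 =
      2 * (p * frobenius_norm A + be * frobenius_norm B) ^+ 2.
    have -> : max_spread fk / (power * M%:R) = max_spread fk / power / M%:R.
      by rewrite -mulrA -invfM.
    by rewrite (sq2 _ Dbar0) (sq2 _ DP0) beE -/p -[X in _ = X * _]s2; ring.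
  move: hM_large => /=; rewrite LE FE; apply: le_trans.
  rewrite ler_wpM2l ?divr_ge0 ?sqr_ge0 ?(ltW s0)// le_max; apply/orP; right.
  by rewrite le_eqVlt; apply/orP; left; apply/eqP; rewrite /V; ring.
have t0 : 0 < 2 * s / eps by rewrite divr_gt0// mulr_gt0.
have T := error_tail Q mX indepX subX mU (@random_sign_independent R _)
  (@random_sign_subgaussian R _) (@random_sign_sqr R _) mal (operator_norm_ge0 A)
  (operator_norm_ge0 B) (frobenius_norm_ge0 A) (frobenius_norm_ge0 B) (sqrtr_ge0 _)
  (sqrtr_ge0 _) al_le A_op B_op A_fro B_fro A_var eps t0 tW.
apply: le_trans; first exact: T.
by rewrite lee_fin; apply: two_expR_le.
Qed.
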